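(* Let $H$ be a Hilbert module over a $C^*$-algebra, and let $(P,Q)$ be a quasi-projection pair on $H$ such that $\|P-Q\|<1$. Then $P=m(Q)$ and $\|Q\|<\frac53$, where $m(Q)$ is the matched projection of $Q$.
   Context: $\mathcal{L}(H)$ is the $C^*$-algebra of adjointable operators on the Hilbert $C^*$-module $H$, and $I$ is the identity operator on $H$. $\mathcal{R}(\cdot)$ and $\mathcal{N}(\cdot)$ denote range and null space. An idempotent is $Q\in\mathcal{L}(H)$ with $Q^2=Q$; a projection is a self-adjoint idempotent. $P_{\mathcal{R}(Q)}$ is the projection of $H$ onto the (orthogonally complemented) range of $Q$. An ordered pair $(P,Q)$, with $P\in\mathcal{L}(H)$ a projection and $Q\in\mathcal{L}(H)$ an idempotent, is called a quasi-projection pair on $H$ if $PQ^*P=PQP$, $PQ^*(I-P)=-PQ(I-P)$, and $(I-P)Q^*(I-P)=(I-P)Q(I-P)$. Definition of the matched projection $m(Q)$ of an idempotent $Q\in\mathcal{L}(H)$: if $Q$ is a projection, $m(Q)=Q$. Otherwise, $H=\mathcal{R}(Q)\dotplus\mathcal{N}(Q^* )$ is an orthogonal decomposition; let $U:H\to\mathcal{R}(Q)\oplus\mathcal{N}(Q^* )$ be the unitary $Uh=\binom{P_{\mathcal{R}(Q)}h}{(I-P_{\mathcal{R}(Q)})h}$, let $I_1$ be the identity on $\mathcal{R}(Q)$, let $A=(Q-P_{\mathcal{R}(Q)})|_{\mathcal{N}(Q^* )}:\mathcal{N}(Q^* )\to\mathcal{R}(Q)$ and $B=(AA^*+I_1)^{1/2}$,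 and set $$m(Q)=U^*\cdot\frac12\begin{pmatrix}(B+I_1)B^{-1} & B^{-1}A\\ A^*B^{-1} & A^*[B(B+I_1)]^{-1}A\end{pmatrix}\cdot U .$$ *)

(* Defs.v *)
From HB Require Import structures.
From mathcomp Require Import all_boot all_order all_algebra complex.
From mathcomp Require Import all_classical all_reals all_analysis.

Set Implicit Arguments.
Unset Strict Implicit.
Unset Printing Implicit Defensive.

Import Order.TTheory GRing.Theory Num.Theory.
Import numFieldNormedType.Exports.

Local Open Scope classical_set_scope.
Local Open Scope ring_scope.
Local Open Scope complex_scope.

(* Complex C*-algebras, not necessarily unital.  Over the scalars R[i] the
   library norm takes its values in R[i]; they are nonnegative reals. *)
HB.mixin Record CompleteNormedModule_isCStarAlgebra (R : realType) A
    of CompleteNormedModule R[i] A := {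
  cmul : A -> A -> A;
  cstar : A -> A;
  cmulA : associative cmul;
  cmulDl : left_distributive cmul +%R;
  cmulDr : right_distributive cmul +%R;
  cmulZl : forall (c : R[i]) (a b : A), cmul (c *: a) b = c *: cmul a b;
  cmulZr : forall (c : R[i]) (a b : A), cmul a (c *: b) = c *: cmul a b;
  cstarK : involutive cstar;
  cstarD : {morph cstar : a b / a + b};
  cstarZ : forall (c : R[i]) (a : A), cstar (c *: a) = c^* *: cstar a;
  cstarM : forall a b : A, cstar (cmul a b) = cmul (cstar b) (cstar a);
  normcM : forall a b : A, `|cmul a b| <= `|a| * `|b|;
  normc_star : forall a : A, `|cmul (cstar a) a| = `|a| ^+ 2
}.

#[short(type="cstarAlgType")]
HB.structure Definition CStarAlgebra (R : realType) :=
  {A of CompleteNormedModule R[i] A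
      & CompleteNormedModule_isCStarAlgebra R A}.

Definition cpositive (R : realType) (A : cstarAlgType R) (a : A) : Prop :=
  exists b : A, a = cmul (cstar b) b.

(* Right A-modules with a nondegenerate A-valued Hermitian form, linear in the
   second variable.  Hilbert modules are the complete positive ones; the weaker
   structure is all that adjoints need, and it spares endowing submodules and
   direct sums of Hilbert modules with a norm. *)
HB.mixin Record Lmodule_isInnerModule (R : realType) (A : cstarAlgType R) H
    of GRing.Lmodule R[i] H := {
  ract : H -> A -> H;
  inner : H -> H -> A;
  ractDl : forall (x y : H) (a : A), ract (x + y) a = ract x a + ract y a;
  ractDr : forall (x : H) (a b : A), ract x (a + b) = ract x a + ract x b;
  ractM : forall (x : H) (a b : A), ract x (cmul a b) = ract (ract x a) b;
  ractZl : forall (c : R[i]) (x : H) (a : A),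
    ract (c *: x) a = c *: ract x a;
  ractZr : forall (c : R[i]) (x : H) (a : A),
    ract x (c *: a) = c *: ract x a;
  innerDr : forall x y z : H, inner x (y + z) = inner x y + inner x z;
  innerZr : forall (c : R[i]) (x y : H), inner x (c *: y) = c *: inner x y;
  inner_act : forall (x y : H) (a : A),
    inner x (ract y a) = cmul (inner x y) a;
  inner_star : forall x y : H, cstar (inner x y) = inner y x;
  inner_nondeg : forall x : H, (forall y : H, inner x y = 0) -> x = 0
}.

#[short(type="innerModType")]
HB.structure Definition InnerModule (R : realType) (A : cstarAlgType R) :=
  {H of GRing.Lmodule R[i] H & Lmodule_isInnerModule R A H}.

(* The last axiom says that the (complete) library norm of H is the one given
   by the inner product. *)
HB.mixin Record InnerModule_isHilbert (R : realType) (A : cstarAlgType R) H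
    of InnerModule R A H & CompleteNormedModule R[i] H := {
  inner_ge0 : forall x : H, cpositive (inner x x : A);
  inner_norm : forall x : H, `|inner x x : A| = `|x| ^+ 2
}.

#[short(type="hilbertModType")]
HB.structure Definition HilbertModule (R : realType) (A : cstarAlgType R) :=
  {H of InnerModule R A H & CompleteNormedModule R[i] H
      & InnerModule_isHilbert R A H}.

Lemma cstar0 (R : realType) (A : cstarAlgType R) : cstar (0 : A) = 0.
Proof. by rewrite -{1}(scale0r (0 : A)) cstarZ rmorph0 scale0r. Qed.

Lemma inner0r (R : realType) (A : cstarAlgType R) (H : innerModType A)
  (x : H) : inner x 0 = 0 :> A.
Proof. by rewrite -{1}(scale0r (0 : H)) innerZr scale0r. Qed.

Lemma inner0l (R : realType) (A : cstarAlgType R) (H : innerModType A)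
  (x : H) : inner 0 x = 0 :> A.
Proof. by rewrite -inner_star inner0r cstar0. Qed.

Lemma innerDl (R : realType) (A : cstarAlgType R) (H : innerModType A)
  (x y z : H) : inner (x + y) z = inner x z + inner y z :> A.
Proof. by rewrite -inner_star innerDr cstarD !inner_star. Qed.

Lemma innerZl (R : realType) (A : cstarAlgType R) (H : innerModType A)
  (c : R[i]) (x y : H) : inner (c *: x) y = c^* *: inner x y :> A.
Proof. by rewrite -inner_star innerZr cstarZ inner_star. Qed.

Lemma innerNl (R : realType) (A : cstarAlgType R) (H : innerModType A)
  (x y : H) : inner (- x) y = - inner x y :> A.
Proof. by rewrite -scaleN1r innerZl rmorphN rmorph1 scaleN1r. Qed.

Lemma innerNr (R : realType) (A : cstarAlgType R) (H : innerModType A)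
  (x y : H) : inner x (- y) = - inner x y :> A.
Proof. by rewrite -scaleN1r innerZr scaleN1r. Qed.

Lemma inner_eq0 (R : realType) (A : cstarAlgType R) (H : hilbertModType A)
  (x : H) : inner x x = 0 :> A -> x = 0.
Proof.
move=> x0; apply/eqP; rewrite -normr_eq0 -sqrf_eq0 -(inner_norm x).
by rewrite x0 normr0.
Qed.

(* If x and y have the same inner products with everything, they agree. *)
Lemma inner_inj (R : realType) (A : cstarAlgType R) (H : innerModType A)
  (x y : H) : (forall z, inner x z = inner y z :> A) -> x = y.
Proof.
move=> xy; apply/eqP; rewrite -subr_eq0; apply/eqP/inner_nondeg => z.
by rewrite innerDl innerNl xy subrr.
Qed.

(* The adjoint is stored in the record; by adjointable_ext it is determined by
   the operator.  Linearity, A-linearity (aop_linear, aop_act) and, on Hilbert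
   modules, boundedness are automatic. *)
Record adjointable (R : realType) (A : cstarAlgType R)
    (H K : innerModType A) := Adjointable {
  aop :> H -> K;
  aadj : K -> H;
  aopP : forall x y, inner (aop x) y = inner x (aadj y) :> A
}.

Notation "''L' ( H , K )" := (adjointable H K)
  (at level 8, H at level 99, K at level 99, format "''L' ( H ,  K )")
  : type_scope.
Notation "''L' ( H )" := (adjointable H H)
  (at level 8, H at level 99, format "''L' ( H )") : type_scope.

Lemma aadjP (R : realType) (A : cstarAlgType R) (H K : innerModType A)
  (T : 'L(H, K)) y x : inner (aadj T y) x = inner y (T x) :> A.
Proof. by rewrite -inner_star -aopP inner_star. Qed.

Lemma adjointable_ext (R : realType) (A : cstarAlgType R)
  (H K : innerModType A) (S T : 'L(H, K)) : S =1 T -> S = T.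
Proof.
case: S T => [s s' sP] [t t' tP] /= /funext st.
move: tP; rewrite -st => tP.
have s't' : s' = t'.
  apply/funext => y; apply: inner_inj => z.
  by rewrite -inner_star -sP tP inner_star.
move: tP; rewrite -s't' => tP; congr Adjointable; exact: Prop_irrelevance.
Qed.

Lemma aop_linear (R : realType) (A : cstarAlgType R) (H K : innerModType A)
  (T : 'L(H, K)) c x y : T (c *: x + y) = c *: T x + T y.
Proof.
by apply: inner_inj => z; rewrite innerDl innerZl !aopP innerDl innerZl.
Qed.

Lemma aop_act (R : realType) (A : cstarAlgType R) (H K : innerModType A)
  (T : 'L(H, K)) x (a : A) : T (ract x a) = ract (T x) a.
Proof.
have act_l (G : innerModType A) (u v : G) (b : A) :
    inner (ract u b) v = cmul (cstar b) (inner u v).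
  by rewrite -inner_star inner_act cstarM inner_star.
by apply: inner_inj => z; rewrite aopP !act_l aopP.
Qed.

HB.instance Definition _ (R : realType) (A : cstarAlgType R)
  (H K : innerModType A) := gen_eqMixin 'L(H, K).
HB.instance Definition _ (R : realType) (A : cstarAlgType R)
  (H K : innerModType A) := gen_choiceMixin 'L(H, K).

Definition azero (R : realType) (A : cstarAlgType R) (H K : innerModType A) :
  'L(H, K).
Proof.
exists (fun=> 0) (fun=> 0) => x y; abstract by rewrite inner0l inner0r.
Defined.

Definition aadd (R : realType) (A : cstarAlgType R) (H K : innerModType A)
  (S T : 'L(H, K)) : 'L(H, K).
Proof.
exists (fun x => S x + T x) (fun y => aadj S y + aadj T y) => x y.
abstract by rewrite innerDl innerDr !aopP.
Defined.

Definition aopp (R : realType) (A : cstarAlgType R) (H K : innerModType A)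
  (T : 'L(H, K)) : 'L(H, K).
Proof.
exists (fun x => - T x) (fun y => - aadj T y) => x y.
abstract by rewrite innerNl innerNr aopP.
Defined.

Definition ascale (R : realType) (A : cstarAlgType R) (H K : innerModType A)
  (c : R[i]) (T : 'L(H, K)) : 'L(H, K).
Proof.
exists (fun x => c *: T x) (fun y => c^* *: aadj T y) => x y.
abstract by rewrite innerZl innerZr aopP.
Defined.

Lemma aaddA (R : realType) (A : cstarAlgType R) (H K : innerModType A) :
  associative (@aadd R A H K).
Proof. by move=> S T U; apply: adjointable_ext => x; exact: addrA. Qed.

Lemma aaddC (R : realType) (A : cstarAlgType R) (H K : innerModType A) :
  commutative (@aadd R A H K).
Proof. by move=> S T; apply: adjointable_ext => x; exact: addrC. Qed.

Lemma aadd0 (R : realType) (A : cstarAlgType R) (H K : innerModType A) :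
  left_id (@azero R A H K) (@aadd R A H K).
Proof. by move=> S; apply: adjointable_ext => x; exact: add0r. Qed.

Lemma aaddN (R : realType) (A : cstarAlgType R) (H K : innerModType A) :
  left_inverse (@azero R A H K) (@aopp R A H K) (@aadd R A H K).
Proof. by move=> S; apply: adjointable_ext => x; exact: addNr. Qed.

HB.instance Definition _ (R : realType) (A : cstarAlgType R)
  (H K : innerModType A) := GRing.isZmodule.Build 'L(H, K)
    (@aaddA R A H K) (@aaddC R A H K) (@aadd0 R A H K) (@aaddN R A H K).

Lemma ascaleA (R : realType) (A : cstarAlgType R) (H K : innerModType A)
  (c d : R[i]) (T : 'L(H, K)) : ascale c (ascale d T) = ascale (c * d) T.
Proof. by apply: adjointable_ext => x; exact: scalerA. Qed.

Lemma ascale1 (R : realType) (A : cstarAlgType R) (H K : innerModType A) :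
  left_id 1 (@ascale R A H K).
Proof. by move=> T; apply: adjointable_ext => x; exact: scale1r. Qed.

Lemma ascaleDr (R : realType) (A : cstarAlgType R) (H K : innerModType A) :
  right_distributive (@ascale R A H K) +%R.
Proof. by move=> c S T; apply: adjointable_ext => x; exact: scalerDr. Qed.

Lemma ascaleDl (R : realType) (A : cstarAlgType R) (H K : innerModType A)
  (T : 'L(H, K)) : {morph (@ascale R A H K)^~ T : c d / c + d}.
Proof. by move=> c d; apply: adjointable_ext => x; exact: scalerDl. Qed.

HB.instance Definition _ (R : realType) (A : cstarAlgType R)
  (H K : innerModType A) := GRing.Zmodule_isLmodule.Build R[i] 'L(H, K)
    (@ascaleA R A H K) (@ascale1 R A H K) (@ascaleDr R A H K)
    (@ascaleDl R A H K).

Definition aid (R : realType) (A : cstarAlgType R) (H : innerModType A) :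
  'L(H) := @Adjointable R A H H id id (fun x y => erefl).
Arguments aid {R A H}.

Definition acomp (R : realType) (A : cstarAlgType R) (H K G : innerModType A)
  (S : 'L(K, G)) (T : 'L(H, K)) : 'L(H, G).
Proof.
exists (S \o T) (aadj T \o aadj S) => x y; abstract by rewrite /= !aopP.
Defined.

Definition adjoint (R : realType) (A : cstarAlgType R) (H K : innerModType A)
  (T : 'L(H, K)) : 'L(K, H) := Adjointable (aadjP T).

Declare Scope adj_scope.
Delimit Scope adj_scope with adj.
Notation "S ** T" := (acomp S T) (at level 40, left associativity) : adj_scope.
Notation "T ^⋆" := (adjoint T) (at level 2, format "T ^⋆")
  : adj_scope.
Local Open Scope adj_scope.

Definition opnorm (R : realType) (A : cstarAlgType R) (H K : hilbertModType A)
    (T : 'L(H, K)) : \bar R :=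
  ereal_sup [set (complex.Re `|T x|)%:E | x in [set x : H | `|x| <= 1]].

Definition is_idempotent (R : realType) (A : cstarAlgType R)
  (H : innerModType A) (Q : 'L(H)) : Prop := Q ** Q = Q.

Definition is_projection (R : realType) (A : cstarAlgType R)
  (H : innerModType A) (P : 'L(H)) : Prop := is_idempotent P /\ P^⋆ = P.

Definition apositive (R : realType) (A : cstarAlgType R) (H : innerModType A)
  (T : 'L(H)) : Prop := exists S : 'L(H), T = S^⋆ ** S.

(* On Hilbert modules, the positive square root, the inverse and the projection
   onto the range are unique when they exist; otherwise the value is 0. *)
Definition asqrt (R : realType) (A : cstarAlgType R) (H : innerModType A)
    (T : 'L(H)) : 'L(H) :=
  xget 0 [set S : 'L(H) | apositive S /\ S ** S = T].

Definition ainv (R : realType) (A : cstarAlgType R) (H K : innerModType A)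
    (T : 'L(H, K)) : 'L(K, H) :=
  xget 0 [set S : 'L(K, H) | S ** T = aid /\ T ** S = aid].

Definition proj_range (R : realType) (A : cstarAlgType R)
    (H : innerModType A) (T : 'L(H)) : 'L(H) :=
  xget 0 [set P : 'L(H) | is_projection P /\ range P = range T].

Record submodule (R : realType) (A : cstarAlgType R) (H : hilbertModType A) :=
  Submodule {
  subm_set : set H;
  subm0 : subm_set 0;
  submP : forall (c : R[i]) x y,
    subm_set x -> subm_set y -> subm_set (c *: x + y);
  subm_act : forall x (a : A), subm_set x -> subm_set (ract x a)
}.

Definition subm_pred (R : realType) (A : cstarAlgType R)
  (H : hilbertModType A) (M : submodule H) : {pred H} :=
  fun x => `[< subm_set M x >].

Lemma subm_pred_closed (R : realType) (A : cstarAlgType R)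
  (H : hilbertModType A) (M : submodule H) : submod_closed (subm_pred M).
Proof.
split; first exact/asboolP/subm0.
by move=> c x y /asboolP Mx /asboolP My; exact/asboolP/submP.
Qed.

HB.instance Definition _ (R : realType) (A : cstarAlgType R)
  (H : hilbertModType A) (M : submodule H) :=
  GRing.isSubmodClosed.Build R[i] H (subm_pred M) (subm_pred_closed M).

Record subm_type (R : realType) (A : cstarAlgType R) (H : hilbertModType A)
  (M : submodule H) := SubmType {
  submval : H;
  submvalP : submval \in subm_pred M
}.

HB.instance Definition _ (R : realType) (A : cstarAlgType R)
  (H : hilbertModType A) (M : submodule H) := [isSub for @submval R A H M].
HB.instance Definition _ (R : realType) (A : cstarAlgType R)
  (H : hilbertModType A) (M : submodule H) := [Choice of subm_type M by <:].
HB.instance Definition _ (R : realType) (A : cstarAlgType R)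
  (H : hilbertModType A) (M : submodule H) :=
  [SubChoice_isSubLmodule of subm_type M by <:].

Definition subm_ract (R : realType) (A : cstarAlgType R)
  (H : hilbertModType A) (M : submodule H) (x : subm_type M) (a : A) :
  subm_type M.
Proof.
exists (ract (submval x) a).
abstract by apply/asboolP/subm_act/asboolP/submvalP.
Defined.

Definition subm_inner (R : realType) (A : cstarAlgType R)
  (H : hilbertModType A) (M : submodule H) (x y : subm_type M) : A :=
  inner (submval x) (submval y).

Lemma subm_inner_nondeg (R : realType) (A : cstarAlgType R)
  (H : hilbertModType A) (M : submodule H) (x : subm_type M) :
  (forall y, subm_inner x y = 0) -> x = 0.
Proof. by move=> /(_ x) /inner_eq0 x0; apply: val_inj. Qed.

Lemma subm_ractDl (R : realType) (A : cstarAlgType R)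
  (H : hilbertModType A) (M : submodule H) (x y : subm_type M) (a : A) :
  subm_ract (x + y) a = subm_ract x a + subm_ract y a.
Proof. by apply: val_inj; exact: ractDl. Qed.

Lemma subm_ractDr (R : realType) (A : cstarAlgType R)
  (H : hilbertModType A) (M : submodule H) (x : subm_type M) (a b : A) :
  subm_ract x (a + b) = subm_ract x a + subm_ract x b.
Proof. by apply: val_inj; exact: ractDr. Qed.

Lemma subm_ractM (R : realType) (A : cstarAlgType R)
  (H : hilbertModType A) (M : submodule H) (x : subm_type M) (a b : A) :
  subm_ract x (cmul a b) = subm_ract (subm_ract x a) b.
Proof. by apply: val_inj; exact: ractM. Qed.

Lemma subm_ractZl (R : realType) (A : cstarAlgType R)
  (H : hilbertModType A) (M : submodule H) (c : R[i]) (x : subm_type M) (a : A) :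
  subm_ract (c *: x) a = c *: subm_ract x a.
Proof. by apply: val_inj; exact: ractZl. Qed.

Lemma subm_ractZr (R : realType) (A : cstarAlgType R)
  (H : hilbertModType A) (M : submodule H) (c : R[i]) (x : subm_type M) (a : A) :
  subm_ract x (c *: a) = c *: subm_ract x a.
Proof. by apply: val_inj; exact: ractZr. Qed.

HB.instance Definition _ (R : realType) (A : cstarAlgType R)
    (H : hilbertModType A) (M : submodule H) :=
  @Lmodule_isInnerModule.Build R A (subm_type M) (@subm_ract R A H M)
    (@subm_inner R A H M) (@subm_ractDl R A H M) (@subm_ractDr R A H M)
    (@subm_ractM R A H M) (@subm_ractZl R A H M) (@subm_ractZr R A H M)
    (fun x y z => innerDr (submval x) (submval y) (submval z))
    (fun c x y => innerZr c (submval x) (submval y))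
    (fun x y a => inner_act (submval x) (submval y) a)
    (fun x y => inner_star (submval x) (submval y))
    (@subm_inner_nondeg R A H M).

Definition range_sub (R : realType) (A : cstarAlgType R)
  (H : hilbertModType A) (T : 'L(H)) : submodule H.
Proof.
exists (range T).
- abstract by exists 0 => //; apply: inner_inj => z; rewrite aopP !inner0l.
- abstract by move=> c _ _ [x _ <-] [y _ <-]; exists (c *: x + y) => //;
    exact: aop_linear.
- abstract by move=> _ a [x _ <-]; exists (ract x a) => //; exact: aop_act.
Defined.

Definition null_sub (R : realType) (A : cstarAlgType R)
  (H : hilbertModType A) (T : 'L(H)) : submodule H.
Proof.
exists (T @^-1` [set 0]).
- abstract by apply: inner_inj => z; rewrite aopP !inner0l.
- abstract by move=> c x y /= x0 y0; rewrite aop_linear x0 y0 scaler0 addr0.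
- abstract by move=> x a /= x0; rewrite aop_act x0 -(scale0r 0) ractZl !scale0r.
Defined.

Notation "''R' ( T )" := (subm_type (range_sub T))
  (at level 8, T at level 99, format "''R' ( T )") : type_scope.
Notation "''N' ( T )" := (subm_type (null_sub T))
  (at level 8, T at level 99, format "''N' ( T )") : type_scope.

(* The orthogonal direct sum lives on the product type. *)
Definition dsum_ract (R : realType) (A : cstarAlgType R)
  (H K : innerModType A) (x : H * K) (a : A) : H * K :=
  (ract x.1 a, ract x.2 a).

Definition dsum_inner (R : realType) (A : cstarAlgType R)
  (H K : innerModType A) (x y : H * K) : A :=
  inner x.1 y.1 + inner x.2 y.2.

Lemma dsum_innerDr (R : realType) (A : cstarAlgType R)
  (H K : innerModType A) (x y z : H * K) :
  dsum_inner x (y + z) = dsum_inner x y + dsum_inner x z.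
Proof. by rewrite /dsum_inner !innerDr addrACA. Qed.

Lemma dsum_innerZr (R : realType) (A : cstarAlgType R)
  (H K : innerModType A) (c : R[i]) (x y : H * K) :
  dsum_inner x (c *: y) = c *: dsum_inner x y.
Proof. by rewrite /dsum_inner !innerZr scalerDr. Qed.

Lemma dsum_inner_act (R : realType) (A : cstarAlgType R)
  (H K : innerModType A) (x y : H * K) (a : A) :
  dsum_inner x (dsum_ract y a) = cmul (dsum_inner x y) a.
Proof. by rewrite /dsum_inner !inner_act cmulDl. Qed.

Lemma dsum_inner_star (R : realType) (A : cstarAlgType R)
  (H K : innerModType A) (x y : H * K) :
  cstar (dsum_inner x y) = dsum_inner y x.
Proof. by rewrite /dsum_inner cstarD !inner_star. Qed.

Lemma dsum_inner_nondeg (R : realType) (A : cstarAlgType R)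
  (H K : innerModType A) (x : H * K) :
  (forall y, dsum_inner x y = 0) -> x = 0.
Proof.
case: x => x1 x2 x0; congr pair; apply: inner_nondeg => y.
  by have := x0 (y, 0); rewrite /dsum_inner /= inner0r addr0.
by have := x0 (0, y); rewrite /dsum_inner /= inner0r add0r.
Qed.

HB.instance Definition _ (R : realType) (A : cstarAlgType R)
    (H K : innerModType A) :=
  @Lmodule_isInnerModule.Build R A (H * K)%type (@dsum_ract R A H K)
    (@dsum_inner R A H K)
    (fun x y a => f_equal2 pair (ractDl x.1 y.1 a) (ractDl x.2 y.2 a))
    (fun x a b => f_equal2 pair (ractDr x.1 a b) (ractDr x.2 a b))
    (fun x a b => f_equal2 pair (ractM x.1 a b) (ractM x.2 a b))
    (fun c x a => f_equal2 pair (ractZl c x.1 a) (ractZl c x.2 a))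
    (fun c x a => f_equal2 pair (ractZr c x.1 a) (ractZr c x.2 a))
    (@dsum_innerDr R A H K) (@dsum_innerZr R A H K) (@dsum_inner_act R A H K)
    (@dsum_inner_star R A H K) (@dsum_inner_nondeg R A H K).

Definition block_op (R : realType) (A : cstarAlgType R)
  (H1 H2 K1 K2 : innerModType A) (T11 : 'L(H1, K1)) (T12 : 'L(H2, K1))
  (T21 : 'L(H1, K2)) (T22 : 'L(H2, K2)) :
  'L((H1 * H2)%type, (K1 * K2)%type).
Proof.
exists (fun x => (T11 x.1 + T12 x.2, T21 x.1 + T22 x.2))
  (fun y => (aadj T11 y.1 + aadj T21 y.2, aadj T12 y.1 + aadj T22 y.2)) => x y.
abstract by rewrite -[LHS]/(dsum_inner _ y) -[RHS]/(dsum_inner x _)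
  /dsum_inner /= !innerDl !innerDr !aopP addrACA.
Defined.

Definition quasi_projection_pair (R : realType) (A : cstarAlgType R)
    (H : innerModType A) (P Q : 'L(H)) : Prop :=
  [/\ is_projection P, is_idempotent Q,
      P ** Q^⋆ ** P = P ** Q ** P,
      P ** Q^⋆ ** (aid - P) = - (P ** Q ** (aid - P)) &
      (aid - P) ** Q^⋆ ** (aid - P) = (aid - P) ** Q ** (aid - P)].

(* mp_U is the unitary h |-> (P h, (I - P) h), and mp_A the restriction of
   Q - P, where P is the projection onto the range of Q.  Each is picked by its
   values, which determine it: giving it as an explicit function into the
   submodules would need a proof, valid for idempotent Q only, that the range is
   orthogonally complemented. *)
Definition mp_U (R : realType) (A : cstarAlgType R) (H : hilbertModType A)
    (Q : 'L(H)) : 'L(H, ('R(Q) * 'N(Q^⋆))%type) :=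
  xget 0 [set U : 'L(H, ('R(Q) * 'N(Q^⋆))%type) | forall h : H,
    submval (U h).1 = proj_range Q h /\
    submval (U h).2 = (aid - proj_range Q) h].

Definition mp_A (R : realType) (A : cstarAlgType R) (H : hilbertModType A)
    (Q : 'L(H)) : 'L('N(Q^⋆), 'R(Q)) :=
  xget 0 [set T : 'L('N(Q^⋆), 'R(Q)) | forall x : 'N(Q^⋆),
    submval (T x) = (Q - proj_range Q) (submval x)].

Definition mp_B (R : realType) (A : cstarAlgType R) (H : hilbertModType A)
    (Q : 'L(H)) : 'L('R(Q)) :=
  asqrt (mp_A Q ** (mp_A Q)^⋆ + aid).

Definition matched_projection (R : realType) (A : cstarAlgType R)
    (H : hilbertModType A) (Q : 'L(H)) : 'L(H) :=
  let U := mp_U Q in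
  let T := mp_A Q in
  let B := mp_B Q in
  if `[< is_projection Q >] then Q else
  U^⋆ **
  (2^-1 *: block_op ((B + aid) ** ainv B) (ainv B ** T)
                    (T^⋆ ** ainv B) (T^⋆ ** ainv (B ** (B + aid)) ** T))
  ** U.

(* Main.v *)
Require Import Defs.
From HB Require Import structures.
From mathcomp Require Import all_boot all_order all_algebra complex.
From mathcomp Require Import all_classical all_reals all_analysis.
From mathcomp Require Import ring lra.
From Stdlib Require Ncring Ncring_tac.

(* Put J = 2P - I and E = 2Q - I. The quasi-projection identities say that
   Q^* = J Q J, so T = J E is self-adjoint with inverse E J = J T J, and
   |P - Q| < 1 says |I - T| < 2. The spectrum of T lies in ]-1, 3[ and is stable
   under inversion, hence lies in ]1/3, 3[; so c = (T + T^-1) / 2 satisfies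
   I <= c < 5/3. Moreover c commutes with P and Q, c J = Q + Q^* - I and
   Q Q^* Q = c^2 Q. The last identity makes c^-1 Q a partial isometry, whence
   |Q| <= |c| < 5/3, and makes c the operator (A A^* + I)^(1/2) on the range of
   Q; substituting it in the block formula gives m(Q) = (I + c^-1 (Q + Q^* - I)) / 2
   = (I + J) / 2 = P.

   No functional calculus is needed. Square roots and inverses of operators close
   to a multiple of I are fixed points of contractions. Inequalities between
   self-adjoint operators are replaced by identities a^2 + w^2 = t with a and w
   commuting: then (a +- i w) / sqrt t are isometries, so |a| <= sqrt t. *)

Set Implicit Arguments.
Unset Strict Implicit.
Unset Printing Implicit Defensive.

Import Order.TTheory GRing.Theory Num.Theory.
Import numFieldNormedType.Exports.

Local Open Scope classical_set_scope.
Local Open Scope ring_scope.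
Local Open Scope complex_scope.
Local Open Scope adj_scope.

Section OperatorRing.
Context (R : realType) (A : cstarAlgType R) (H : innerModType A).
Implicit Types S T U : 'L(H).

Lemma aopD (K : innerModType A) (S : 'L(H, K)) x y : S (x + y) = S x + S y.
Proof. by have := aop_linear S 1 x y; rewrite !scale1r. Qed.

Lemma aop0 (K : innerModType A) (S : 'L(H, K)) : S 0 = 0.
Proof. by have := aopD S 0 0; rewrite addr0 -[LHS]addr0 => /addrI. Qed.

Lemma aopZ (K : innerModType A) (S : 'L(H, K)) c x : S (c *: x) = c *: S x.
Proof. by have := aop_linear S c x 0; rewrite !(aop0, addr0). Qed.

Lemma acompA : associative (@acomp R A H H H).
Proof. by move=> S T U; exact: adjointable_ext. Qed.

Lemma acomp1l : left_id (@aid R A H) (@acomp R A H H H).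
Proof. by move=> S; exact: adjointable_ext. Qed.

Lemma acomp1r : right_id (@aid R A H) (@acomp R A H H H).
Proof. by move=> S; exact: adjointable_ext. Qed.

Lemma acompDl : left_distributive (@acomp R A H H H) +%R.
Proof. by move=> S T U; exact: adjointable_ext. Qed.

Lemma acompDr : right_distributive (@acomp R A H H H) +%R.
Proof. by move=> S T U; apply: adjointable_ext => x; exact: aopD. Qed.

End OperatorRing.

HB.instance Definition _ (R : realType) (A : cstarAlgType R)
  (H : innerModType A) := GRing.Zmodule_isPzRing.Build 'L(H)
    (@acompA R A H) (@acomp1l R A H) (@acomp1r R A H) (@acompDl R A H)
    (@acompDr R A H).

Lemma acomp_scalel (R : realType) (A : cstarAlgType R) (H : innerModType A)
  (c : R[i]) (S T : 'L(H)) : (c *: S) * T = c *: (S * T).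
Proof. exact: adjointable_ext. Qed.

Lemma acomp_scaler (R : realType) (A : cstarAlgType R) (H : innerModType A)
  (c : R[i]) (S T : 'L(H)) : S * (c *: T) = c *: (S * T).
Proof. by apply: adjointable_ext => x; rewrite [LHS]aopZ. Qed.

#[local] Instance adjointable_ring_ops (R : realType) (A : cstarAlgType R)
    (H : innerModType A) :
  @Ncring.Ring_ops 'L(H) 0 1 +%R *%R (fun S T => S - T) -%R eq := {}.

#[local] Instance adjointable_ring (R : realType) (A : cstarAlgType R)
  (H : innerModType A) : Ncring.Ring (Ro := @adjointable_ring_ops R A H).
Proof.
split; [exact: (@RelationClasses.eq_equivalence 'L(H)) |
  by move=> ? ? -> ? ? -> | by move=> ? ? -> ? ? -> | by move=> ? ? -> ? ? -> |
  by move=> ? ? -> | exact: add0r | exact: addrC | exact: addrA | exact: mul1r |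
  exact: mulr1 | exact: mulrA | exact: mulrDl | | by [] | exact: subrr].
by move=> S T U; exact: mulrDr.
Qed.
Ltac ncring := Ncring_tac.non_commutative_ring.

Section Adjoint.
Context (R : realType) (A : cstarAlgType R).

Lemma adjointD (H K : innerModType A) (S T : 'L(H, K)) : (S + T)^⋆ = S^⋆ + T^⋆.
Proof. exact: adjointable_ext. Qed.

Lemma adjointN (H K : innerModType A) (S : 'L(H, K)) : (- S)^⋆ = - S^⋆.
Proof. exact: adjointable_ext. Qed.

Lemma adjointZ (H K : innerModType A) c (S : 'L(H, K)) :
  (c *: S)^⋆ = (c^*)%R *: S^⋆.
Proof. exact: adjointable_ext. Qed.

Lemma adjointM (H : innerModType A) (S T : 'L(H)) : (S * T)^⋆ = T^⋆ * S^⋆.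
Proof. exact: adjointable_ext. Qed.

Lemma adjoint1 (H : innerModType A) : (1 : 'L(H))^⋆ = 1.
Proof. exact: adjointable_ext. Qed.

Lemma adjointK (H K : innerModType A) (S : 'L(H, K)) : (S^⋆)^⋆ = S.
Proof. exact: adjointable_ext. Qed.

Lemma adjointP (H K : innerModType A) (S : 'L(H, K)) x y :
  inner (S x) y = inner x (S^⋆ y) :> A.
Proof. exact: aopP. Qed.

End Adjoint.

Definition rnorm (R : realType) (V : normedModType R[i]) (x : V) : R :=
  complex.Re `|x|.

Section RealNorm.
Context (R : realType) (V : normedModType R[i]).
Implicit Types x y : V.

Lemma rnormE x : `|x| = (rnorm x)%:C.
Proof. by rewrite /rnorm RRe_real // normr_real. Qed.

Lemma rnorm_ge0 x : 0 <= rnorm x.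
Proof. by rewrite -lecR -rnormE normr_ge0. Qed.

Lemma rnorm_eq0 x : (rnorm x == 0) = (x == 0).
Proof. by rewrite -[x == 0]normr_eq0 rnormE (inj_eq (@complexI R)). Qed.

Lemma rnorm0 : rnorm (0 : V) = 0.
Proof. by apply/eqP; rewrite rnorm_eq0. Qed.

Lemma rnormN x : rnorm (- x) = rnorm x.
Proof. by rewrite /rnorm normrN. Qed.

Lemma rnormD x y : rnorm (x + y) <= rnorm x + rnorm y.
Proof. by rewrite -lecR rmorphD /= -!rnormE ler_normD. Qed.

Lemma rnormB x y : rnorm (x - y) <= rnorm x + rnorm y.
Proof. by rewrite -(rnormN y) rnormD. Qed.

Lemma rnormZ (c : R[i]) x : rnorm (c *: x) = complex.Re `|c| * rnorm x.
Proof.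
apply: (@complexI R); rewrite rmorphM /= -!rnormE normrZ; congr (_ * _).
Qed.

Lemma rnormZr (a : R) x : 0 <= a -> rnorm (a%:C *: x) = a * rnorm x.
Proof.
by move=> a0; rewrite rnormZ normc_def /= expr0n addr0 sqrtr_sqr ger0_norm.
Qed.

End RealNorm.

Lemma rnorm_geometric_cvg (R : realType) (V : completeNormedModType R[i])
    (u : nat -> V) (C q : R) : 0 <= q < 1 ->
    (forall n m, rnorm (u (n + m)%N - u n) <= C * q ^+ n) ->
  exists l, forall n, rnorm (l - u n) <= C * q ^+ n.
Proof.
move=> /andP[q0 q1] uP.
have C0 : 0 <= C by have := le_trans (rnorm_ge0 _) (uP 0 0)%N; rewrite mulr1.
have Cq0 e : 0 < e -> exists n, C * q ^+ n < e.
  move=> e0; have qn : (fun n => C * q ^+ n) @ \oo --> C * 0.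
    apply: cvgMr; apply: cvg_expr; by rewrite ger0_norm.
  rewrite mulr0 in qn; move/cvgrPdist_lt: qn => /(_ e e0) [n _ /(_ n (leqnn n))] /=.
  by rewrite sub0r normrN ger0_norm ?mulr_ge0 ?exprn_ge0 // => ?; exists n.
have cu : cauchy (u @ \oo).
  apply/cauchy_exP => e e0; have [n ne] : exists n, (C * q ^+ n)%:C < e.
    have re : e = (complex.Re e)%:C by rewrite RRe_real // gtr0_real.
    by rewrite re ltcR in e0; have [n ?] := Cq0 _ e0; exists n; rewrite re ltcR.
  exists (u n), n => // m /= /subnKC <-.
  by rewrite -ball_normE /= distrC rnormE (le_lt_trans _ ne) // lecR.
exists (lim (u @ \oo)) => n; apply/ler_addgt0Pr => e e0.
have /cvgrPdist_lt /(_ e%:C) : u @ \oo --> lim (u @ \oo) by exact: cauchy_cvg.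
rewrite ltcR => /(_ e0)[k _ /(_ (n + k)%N (leq_addl _ _))] /=.
rewrite rnormE ltcR => ke.
rewrite -(subrKA (u (n + k)%N)) addrC (le_trans (rnormD _ _))// lerD// ltW//.
Qed.

Lemma le_geometric_lim (R : realType) (a b C q : R) : 0 <= q < 1 ->
  (forall n, a <= C * q ^+ n + b) -> a <= b.
Proof.
move=> /andP[q0 q1] aP.
have qb : (fun n => C * q ^+ n + b) @ \oo --> C * 0 + b.
  apply: cvgD; last exact: cvg_cst.
  by apply: cvgMr; apply: cvg_expr; rewrite ger0_norm.
rewrite mulr0 add0r in qb.
by apply: (ler_cvg_to (cvg_cst a) qb); exact: nearW.
Qed.

Lemma rnorm_geometric_eq0 (R : realType) (V : normedModType R[i]) (v : V) C q :
  0 <= q < 1 -> (forall n, rnorm v <= C * q ^+ n) -> v = 0.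
Proof.
move=> q01 vP; apply/eqP; rewrite -rnorm_eq0 eq_le rnorm_ge0 andbT.
by apply: (le_geometric_lim q01) => n; rewrite addr0; exact: vP.
Qed.

(* The imaginary unit as a plain complex number, for which real parts and
   conjugates compute. *)
Definition imagC (R : realType) : R[i] := Complex 0 1.
Arguments imagC {R}.

Lemma imagC_sqr (R : realType) : imagC * imagC = -1 :> R[i].
Proof. by rewrite -[RHS]sqr_i expr2. Qed.

Lemma imagC_conj (R : realType) : (imagC^*)%R = - imagC :> R[i].
Proof.
by rewrite -[LHS]/(conjc _); apply/eqP; rewrite eq_complex /= oppr0 !eqxx.
Qed.

Lemma rnorm_imagCZ (R : realType) (V : normedModType R[i]) (v : V) :
  rnorm (imagC *: v) = rnorm v.
Proof.
by rewrite rnormZ normc_def /= expr0n expr1n add0r sqrtr1 mul1r.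
Qed.

Section Hilbert.
Context (R : realType) (A : cstarAlgType R) (H : hilbertModType A).
Implicit Types (x y : H) (S T X : 'L(H)).
Lemma innerBl x y (z : H) : inner (x - y) z = inner x z - inner y z :> A.
Proof. by rewrite innerDl innerNl. Qed.

Lemma innerBr x y (z : H) : inner z (x - y) = inner z x - inner z y :> A.
Proof. by rewrite innerDr innerNr. Qed.

Lemma rnorm_inner_self x : rnorm (inner x x : A) = rnorm x ^+ 2.
Proof. by apply: (@complexI R); rewrite rmorphXn /= -!rnormE inner_norm. Qed.

Lemma rnorm_eq_inner x y : inner x x = inner y y :> A -> rnorm x = rnorm y.
Proof.
move=> xy; apply/eqP; rewrite -(@eqrXn2 _ 2) ?rnorm_ge0//.
by rewrite -!rnorm_inner_self xy.
Qed.

Lemma inner_polarization x y :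
  (inner (x + y) (x + y) - inner (x - y) (x - y)) -
  imagC *: (inner (x + imagC *: y) (x + imagC *: y) -
         inner (x - imagC *: y) (x - imagC *: y)) = 4 *: inner x y :> A.
Proof.
have sq u v : inner (u + v) (u + v)
    = inner u u + inner v v + (inner u v + inner v u) :> A.
  by rewrite innerDl !innerDr (AC (2*2) ((1*4)*(2*3))).
have E u v : inner (u + v) (u + v) - inner (u - v) (u - v)
    = (inner u v + inner v u) *+ 2 :> A.
  rewrite !sq !(innerNl, innerNr) !opprK -opprD opprB [X in _ + X]addrC.
  by rewrite addrACA subrr add0r mulr2n.
rewrite !E innerZl innerZr imagC_conj scaleNr -scalerBr -scalerMnr scalerA imagC_sqr.
rewrite scaleN1r mulNrn opprK -mulrnDl addrACA [X in _ + X]subrr addr0.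
by rewrite -mulr2n -mulrnA scaler_nat.
Qed.

Lemma rnorm_inner_le_sqr x y :
  rnorm (inner x y : A) <= (rnorm x + rnorm y) ^+ 2.
Proof.
have S z : rnorm z <= rnorm y ->
  rnorm (inner (x + z) (x + z) : A) <= (rnorm x + rnorm y) ^+ 2.
  move=> zy; rewrite rnorm_inner_self lerXn2r ?nnegrE ?addr_ge0 ?rnorm_ge0//.
  by rewrite (le_trans (rnormD _ _))// lerD2l.
have : rnorm (4%:C *: inner x y : A) <= 4 * (rnorm x + rnorm y) ^+ 2.
  rewrite (_ : 4%:C = 4) ?rmorph_nat// -inner_polarization.
  apply: le_trans (rnormB _ _) _; rewrite rnorm_imagCZ.
  have := S y (lexx _).
  have := S (- y); rewrite rnormN => /(_ (lexx _)).
  have := S (imagC *: y); rewrite rnorm_imagCZ => /(_ (lexx _)).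
  have := S (- (imagC *: y)); rewrite rnormN rnorm_imagCZ => /(_ (lexx _)).
  have := rnormB (inner (x + y) (x + y) : A) (inner (x - y) (x - y)).
  have := rnormB (inner (x + imagC *: y) (x + imagC *: y) : A)
                 (inner (x - imagC *: y) (x - imagC *: y)).
  lra.
by rewrite rnormZr// ler_pM2l.
Qed.

(* The constant 4 comes from polarisation; it replaces the Cauchy-Schwarz
   inequality, whose proof needs the order of A. *)
Lemma rnorm_inner_le x y : rnorm (inner x y : A) <= 4 * rnorm x * rnorm y.
Proof.
have [->|x0] := eqVneq x 0; first by rewrite inner0l !rnorm0 mulr0 mul0r.
have [->|y0] := eqVneq y 0; first by rewrite inner0r !rnorm0 mulr0.
have xp : 0 < rnorm x by rewrite lt_def rnorm_eq0 x0 rnorm_ge0.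
have yp : 0 < rnorm y by rewrite lt_def rnorm_eq0 y0 rnorm_ge0.
have := rnorm_inner_le_sqr ((rnorm y)%:C *: x) ((rnorm x)%:C *: y).
rewrite innerZl innerZr -[(_^*)%R]/(conjc _) conjc_real !rnormZr ?rnorm_ge0 //.
rewrite (_ : (_ + _) ^+ 2 = rnorm y * (rnorm x * (4 * rnorm x * rnorm y))).
  by rewrite !ler_pM2l.
by ring.
Qed.

End Hilbert.

Definition bounded_by (R : realType) (A : cstarAlgType R)
    (H : hilbertModType A) (T : 'L(H)) (r : R) : Prop :=
  forall x, rnorm (T x) <= r * rnorm x.

Definition bicommutant_ball (R : realType) (A : cstarAlgType R)
    (H : hilbertModType A) (y : 'L(H)) (r : R) (X : 'L(H)) : Prop :=
  [/\ X^⋆ = X, bounded_by X r &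
      forall b, GRing.comm b y -> GRing.comm b X].

Section Bounded.
Context (R : realType) (A : cstarAlgType R) (H : hilbertModType A).
Implicit Types (x y : H) (S T X : 'L(H)) (r s : R).

Lemma bounded_by1 : bounded_by (1 : 'L(H)) 1.
Proof. by move=> x; rewrite mul1r. Qed.

Lemma bounded_byD S T r s :
  bounded_by S r -> bounded_by T s -> bounded_by (S + T) (r + s).
Proof.
by move=> Sr Ts x; rewrite mulrDl (le_trans (rnormD _ _))// lerD.
Qed.

Lemma bounded_byN T r : bounded_by T r -> bounded_by (- T) r.
Proof. by move=> Tr x; rewrite rnormN. Qed.

Lemma bounded_byB S T r s :
  bounded_by S r -> bounded_by T s -> bounded_by (S - T) (r + s).
Proof. by move=> Sr Ts; exact/bounded_byD/bounded_byN. Qed.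

Lemma bounded_byM S T r s : 0 <= r ->
  bounded_by S r -> bounded_by T s -> bounded_by (S * T) (r * s).
Proof.
by move=> r0 Sr Ts x; rewrite (le_trans (Sr _))// -mulrA ler_wpM2l.
Qed.

Lemma bounded_byZ T r (a : R) : 0 <= a ->
  bounded_by T r -> bounded_by (a%:C *: T) (a * r).
Proof. by move=> a0 Tr x; rewrite rnormZr// -mulrA ler_wpM2l. Qed.

Lemma bounded_byW T r s : r <= s -> bounded_by T r -> bounded_by T s.
Proof.
by move=> rs Tr x; rewrite (le_trans (Tr x))// ler_wpM2r ?rnorm_ge0.
Qed.

Lemma bounded_by_eq0 T r q : 0 <= q < 1 -> 0 <= r -> bounded_by T r ->
  (forall s, 0 <= s -> bounded_by T s -> bounded_by T (q * s)) -> T = 0.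
Proof.
move=> q01 r0 Tr Tq; apply: adjointable_ext => x.
apply: (rnorm_geometric_eq0 (C := r * rnorm x) q01) => n.
suff /(_ x) : bounded_by T (r * q ^+ n) by rewrite mulrAC.
elim: n => [|n IH]; first by rewrite mulr1.
rewrite exprS mulrCA; apply: Tq => //.
by rewrite mulr_ge0// exprn_ge0//; case/andP: q01.
Qed.

Lemma bounded_by_lim T r C q (X : nat -> 'L(H)) : 0 <= q < 1 ->
  (forall n, bounded_by (T - X n) (C * q ^+ n)) ->
  (forall n, bounded_by (X n) r) -> bounded_by T r.
Proof.
move=> q01 TX Xr x; apply: (le_geometric_lim (C := C * rnorm x) q01) => n.
rewrite -[T](subrK (X n)) (le_trans (rnormD _ _))// lerD//.
  by rewrite mulrAC; exact: TX.
exact: Xr.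
Qed.

Lemma comm_lim b T C q (X : nat -> 'L(H)) : 0 <= q < 1 ->
  (forall n, bounded_by (T - X n) (C * q ^+ n)) ->
  (forall n, GRing.comm b (X n)) -> GRing.comm b T.
Proof.
move=> q01 TX bX; apply: adjointable_ext => x; apply: inner_inj => z.
apply/eqP; rewrite -subr_eq0; apply/eqP.
set D := fun n => T - X n.
apply: (rnorm_geometric_eq0
  (C := 4 * C * (rnorm x * rnorm (b^⋆ z) + rnorm (b x) * rnorm z)) q01) => n.
have -> : inner ((b * T) x) z - inner ((T * b) x) z
  = inner (D n x) (b^⋆ z) - inner (D n (b x)) z :> A.
  rewrite -[D n x]/(T x - X n x) -[D n (b x)]/(T (b x) - X n (b x)).
  rewrite !innerBl -!adjointP -[b (X n x)]/((b * X n) x) bX.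
  by rewrite opprB addrA subrK.
rewrite (le_trans (rnormB _ _))//.
have h1 := TX n x; have h2 := TX n (b x).
apply: (@le_trans _ _ (4 * (C * q ^+ n * rnorm x) * rnorm (b^⋆ z) +
   4 * (C * q ^+ n * rnorm (b x)) * rnorm z));
  last by rewrite le_eqVlt; apply/orP; left; apply/eqP; ring.
rewrite lerD// (le_trans (rnorm_inner_le _ _))// ler_wpM2r ?rnorm_ge0//;
  by rewrite ler_wpM2l.
Qed.

Lemma adjointable_lim (X : nat -> 'L(H)) C q : 0 <= q < 1 ->
    (forall n, (X n)^⋆ = X n) ->
    (forall n m, bounded_by (X (n + m)%N - X n) (C * q ^+ n)) ->
  exists T : 'L(H), T^⋆ = T /\ forall n, bounded_by (T - X n) (C * q ^+ n).
Proof.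
move=> q01 Xsa Xc.
have /choice[l lP] x : exists l, forall n,
    rnorm (l - X n x) <= C * rnorm x * q ^+ n.
  by apply: rnorm_geometric_cvg => // n m; rewrite mulrAC; exact: Xc.
have lsa x y : inner (l x) y = inner x (l y) :> A.
  apply/eqP; rewrite -subr_eq0; apply/eqP.
  apply: (rnorm_geometric_eq0 (C := 8 * C * rnorm x * rnorm y) q01) => n.
  have -> : inner (l x) y - inner x (l y)
      = inner (l x - X n x) y - inner x (l y - X n y) :> A.
    by rewrite innerBl innerBr adjointP Xsa opprB addrA subrK.
  have h1 := lP x n; have h2 := lP y n.
  rewrite (le_trans (rnormB _ _))//.
  apply: (@le_trans _ _ (4 * (C * rnorm x * q ^+ n) * rnorm y +
    4 * rnorm x * (C * rnorm y * q ^+ n)));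
  last by rewrite le_eqVlt; apply/orP; left; apply/eqP; ring.
  rewrite lerD// (le_trans (rnorm_inner_le _ _))//.
    by rewrite ler_wpM2r ?rnorm_ge0// ler_wpM2l.
  by rewrite ler_wpM2l// mulr_ge0// rnorm_ge0.
exists (Adjointable lsa); split; first exact: adjointable_ext.
by move=> n x; rewrite mulrAC; exact: lP.
Qed.

Lemma bicommutant_ball_fixpoint (F : 'L(H) -> 'L(H)) (y : 'L(H)) r q :
    0 <= q < 1 -> 0 <= r ->
    (forall X, bicommutant_ball y r X -> bicommutant_ball y r (F X)) ->
    (forall X Y e, bicommutant_ball y r X -> bicommutant_ball y r Y ->
      0 <= e -> bounded_by (X - Y) e -> bounded_by (F X - F Y) (q * e)) ->
  exists2 X, bicommutant_ball y r X & F X = X.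
Proof.
move=> q01 r0 Fr Fq; have /andP[q0 q1] := q01; pose X n := iter n F 0.
have Xr n : bicommutant_ball y r (X n).
  elim: n => [|n IH]; last exact: Fr.
  split=> [|x|b _]; [exact: adjointable_ext| |exact: commr0].
  by rewrite rnorm0 mulr_ge0 ?rnorm_ge0.
have XS n : bounded_by (X n.+1 - X n) (r * q ^+ n).
  elim: n => [|n IH].
    by rewrite subr0 mulr1; case: (Xr 1).
  rewrite exprS mulrCA; apply: (Fq _ _ _ (Xr _) (Xr _) _ IH).
  by rewrite mulr_ge0 ?exprn_ge0.
have qn0 : 1 - q != 0 by lra.
have C0 : 0 <= r / (1 - q) by rewrite mulr_ge0// invr_ge0; lra.
have Xc n m : bounded_by (X (n + m)%N - X n) (r / (1 - q) * q ^+ n).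
  elim: m n => [|m IH] n.
    rewrite addn0 subrr => x; rewrite rnorm0.
    by rewrite mulr_ge0 ?rnorm_ge0// mulr_ge0 ?exprn_ge0.
  rewrite -addSnnS -(subrK (X n.+1) (X (n.+1 + m)%N)) -addrA.
  have -> : r / (1 - q) * q ^+ n = r / (1 - q) * q ^+ n.+1 + r * q ^+ n.
    by rewrite exprS; field.
  exact: bounded_byD.
have [T [Tsa TX]] := adjointable_lim q01 (fun n => let: And3 h _ _ := Xr n in h) Xc.
have Tr : bicommutant_ball y r T.
  split=> //; first by apply: (bounded_by_lim q01 TX) => n; case: (Xr n).
  by move=> b yb; apply: (comm_lim q01 TX) => n; case: (Xr n) => _ _; exact.
exists T => //; apply/eqP; rewrite -subr_eq0; apply/eqP.
apply: adjointable_ext => x; set C := r / (1 - q).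
apply: (rnorm_geometric_eq0 (C := 2 * q * C * rnorm x) q01) => n.
rewrite -(subrKA (X n.+1)).
apply: le_trans (_ : (q * (C * q ^+ n) + C * q ^+ n.+1) * rnorm x <= _); last first.
  by rewrite le_eqVlt; apply/orP; left; apply/eqP; rewrite exprS; ring.
apply: (@bounded_byD (F T - X n.+1) (X n.+1 - T)) x.
  by apply: Fq => //; rewrite mulr_ge0 ?exprn_ge0.
by rewrite -opprB; exact: bounded_byN.
Qed.

End Bounded.

Definition scalar_op (R : realType) (A : cstarAlgType R) (H : innerModType A)
  (t : R) : 'L(H) := t%:C *: (1 : 'L(H)).

Arguments scalar_op {R A H} t.
Notation "t %:I" := (scalar_op t) (at level 1, left associativity, format "t %:I").

Section Roots.
Context (R : realType) (A : cstarAlgType R) (H : hilbertModType A).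
Implicit Types (x : H) (S T X y : 'L(H)) (r s q t : R).

Lemma commrZ (b T : 'L(H)) (c : R[i]) :
  GRing.comm b T -> GRing.comm b (c *: T).
Proof. by move=> bT; rewrite /GRing.comm acomp_scaler acomp_scalel bT. Qed.

Lemma adjointZr (a : R) T : (a%:C *: T)^⋆ = a%:C *: T^⋆.
Proof. by rewrite adjointZ -[(_^*)%R]/(conjc _) conjc_real. Qed.

Lemma scalar_opE t T : t%:I * T = t%:C *: T.
Proof. by rewrite acomp_scalel mul1r. Qed.

Lemma comm_scalar_op t T : GRing.comm T t%:I.
Proof. exact/commrZ/commr1. Qed.

Lemma adjoint_scalar_op t : (t%:I : 'L(H))^⋆ = t%:I.
Proof. by rewrite adjointZr adjoint1. Qed.

Lemma scalar_op1 : 1%:I = 1 :> 'L(H).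
Proof. exact: scale1r. Qed.

Lemma scalar_opD s t : (s + t)%:I = s%:I + t%:I :> 'L(H).
Proof. by rewrite /scalar_op rmorphD /= scalerDl. Qed.

Lemma scalar_opM s t : (s * t)%:I = s%:I * t%:I :> 'L(H).
Proof. by rewrite scalar_opE /scalar_op scalerA rmorphM. Qed.

Lemma half_add T : (1 / 2)%:C *: (T + T) = T.
Proof.
rewrite scalerDr -scalerDl -rmorphD /=.
by rewrite (_ : 1 / 2 + 1 / 2 = 1) ?scale1r//; field.
Qed.

Lemma sqrt1_exists y q : y^⋆ = y -> 0 <= q < 1 -> bounded_by y q ->
  exists w : 'L(H), [/\ w^⋆ = w, forall b, GRing.comm b y -> GRing.comm b w
    & w * w = 1 - y].
Proof.
move=> ysa /andP[q0 q1] yq; pose F X := (1 / 2)%:C *: (y + X * X).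
have q01 : 0 <= q < 1 by rewrite q0.
have [||X [Xr _ Xy] FX] := @bicommutant_ball_fixpoint _ _ H F y q q q01 q0.
- move=> X [Xsa Xq Xy]; split.
  + by rewrite /F adjointZr adjointD adjointM ysa Xsa.
  + apply: (@bounded_byW _ _ _ _ (1 / 2 * (q + q * q))); first by nra.
    by apply: bounded_byZ; [lra|exact/bounded_byD/bounded_byM].
  + move=> b yb; apply: commrZ; apply: commrD => //.
    by apply: commrM; exact: Xy.
- move=> X Y e [Xsa Xq _] [Ysa Yq _] e0 XY.
  have -> : F X - F Y = (1 / 2)%:C *: (X * (X - Y) + (X - Y) * Y).
    by rewrite /F -scalerBr; congr (_ *: _); ncring.
  rewrite (_ : q * e = 1 / 2 * (q * e + e * q)); last by field.
  by apply: bounded_byZ; [lra|apply: bounded_byD; exact: bounded_byM].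
exists (1 - X); split.
- by rewrite adjointD adjointN adjoint1 Xr.
- by move=> b yb; apply: commrB; [exact: commr1|exact: Xy].
- have := half_add (y + X * X); rewrite scalerDr -/(F X) FX => XX.
  have {}FX : X * X = X + X - y by rewrite XX; ncring.
  rewrite (_ : _ * _ = 1 - (X + X) + X * X); last by ncring.
  by rewrite FX; ncring.
Qed.

Lemma inverse1_exists y q : y^⋆ = y -> 0 <= q < 1 -> bounded_by y q ->
  exists e : 'L(H), [/\ e^⋆ = e, bounded_by e (1 / (1 - q)),
    forall b, GRing.comm b y -> GRing.comm b e & e * (1 - y) = 1].
Proof.
move=> ysa /andP[q0 q1] yq; pose F X := 1 + y * X.
have rE : 1 / (1 - q) = 1 + q * (1 / (1 - q)).
  by field; rewrite subr_eq0 eq_sym lt_eqF.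
have r0 : 0 <= 1 / (1 - q) by rewrite div1r invr_ge0; lra.
have q01 : 0 <= q < 1 by rewrite q0.
have [||X [Xr Xb Xy] FX] := @bicommutant_ball_fixpoint _ _ H F y _ q q01 r0.
- move=> X [Xsa Xq Xy]; split.
  + by rewrite /F adjointD adjointM adjoint1 ysa Xsa -(Xy y).
  + by rewrite rE; apply: bounded_byD; [exact: bounded_by1|exact: bounded_byM].
  + move=> b yb; apply: commrD; first exact: commr1.
    by apply: commrM => //; exact: Xy.
- move=> X Y e _ _ e0 XY; rewrite (_ : F X - F Y = y * (X - Y)).
    exact: bounded_byM.
  by rewrite /F; ncring.
exists X; split => //; rewrite mulrBr mulr1 -(Xy y)// -{1}FX /F.
by rewrite addrK.
Qed.

Lemma sqrt_exists y q t : y^⋆ = y -> 0 <= q < t -> bounded_by y q ->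
  exists w : 'L(H), [/\ w^⋆ = w, forall b, GRing.comm b y -> GRing.comm b w
    & w * w = t%:I - y].
Proof.
move=> ysa /andP[q0 qt] yq; have t0 : 0 < t by apply: le_lt_trans qt.
have [|||w [wsa wy ww]] := @sqrt1_exists (t^-1%:C *: y) (t^-1 * q).
- by rewrite adjointZr ysa.
- by rewrite [X in X < _]mulrC ltr_pdivrMr// mul1r qt mulr_ge0 ?invr_ge0 // ltW.
- by apply: bounded_byZ => //; rewrite invr_ge0 ltW.
exists ((Num.sqrt t)%:C *: w); split; first by rewrite adjointZr wsa.
- by move=> b yb; apply: commrZ; apply: wy; exact: commrZ.
- rewrite acomp_scalel acomp_scaler ww scalerA -rmorphM /= -expr2.
  rewrite sqr_sqrtr ?ltW// scalerBr scalerA -rmorphM /= divff ?gt_eqF//.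
  by rewrite scale1r.
Qed.

Lemma inverse_exists y q t : y^⋆ = y -> 0 <= q < t -> bounded_by y q ->
  exists e : 'L(H), [/\ e^⋆ = e, forall b, GRing.comm b y -> GRing.comm b e
    & e * (t%:I - y) = 1].
Proof.
move=> ysa /andP[q0 qt] yq; have t0 : 0 < t by apply: le_lt_trans qt.
have [|||e [esa _ ey ee]] := @inverse1_exists (t^-1%:C *: y) (t^-1 * q).
- by rewrite adjointZr ysa.
- by rewrite [X in X < _]mulrC ltr_pdivrMr// mul1r qt mulr_ge0 ?invr_ge0 // ltW.
- by apply: bounded_byZ => //; rewrite invr_ge0 ltW.
exists (t^-1%:C *: e); split; first by rewrite adjointZr esa.
- by move=> b yb; apply: commrZ; apply: ey; exact: commrZ.
- rewrite acomp_scalel -acomp_scaler scalerBr scalerA -rmorphM /= mulVf ?gt_eqF//.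
  by rewrite scale1r.
Qed.

(* a + iw and a - iw are sqrt t times isometries, and a is their mean. *)
Lemma sqr_sum_bounded (a w : 'L(H)) t : a^⋆ = a -> w^⋆ = w ->
  GRing.comm a w -> a * a + w * w = t%:I -> 0 <= t ->
  bounded_by a (Num.sqrt t).
Proof.
move=> asa wsa aw awt t0 x.
have U (c : R[i]) : (c^*)%R = - c -> c * c = -1 ->
    rnorm (a x + c *: w x) = Num.sqrt t * rnorm x.
  move=> cc c2; rewrite -rnormZr ?sqrtr_ge0//; apply: rnorm_eq_inner.
  rewrite innerZl innerZr -[(_%:C^*)%R]/(conjc _) conjc_real scalerA.
  rewrite -rmorphM /= -expr2 sqr_sqrtr// -innerZr.
  rewrite innerDl !innerDr !innerZl !innerZr cc scalerA mulNr c2 opprK scale1r.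
  rewrite !adjointP asa wsa -[a (w x)]/((a * w) x) aw -[a (a x)]/((a * a) x).
  rewrite -[w (w x)]/((w * w) x) -[w (a x)]/((w * a) x) scaleNr.
  rewrite (AC (2*2) ((1*4)*(2*3))) /= subrr addr0 -innerDr.
  rewrite -[X in inner _ X]/((a * a + w * w) x) awt; exact: innerZr.
have U1 := U imagC (imagC_conj R) (imagC_sqr R).
have U2 : rnorm (a x + - imagC *: w x) = Num.sqrt t * rnorm x.
  by apply: U; rewrite ?mulrNN ?imagC_sqr// rmorphN /= imagC_conj.
have : rnorm (2%:C *: a x) <= 2 * (Num.sqrt t * rnorm x).
  rewrite (_ : _ *: _ = (a x + imagC *: w x) + (a x + - imagC *: w x)).
    by rewrite (le_trans (rnormD _ _))// U1 U2 -mulr2n mulr_natl.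
  by rewrite scaleNr addrACA subrr addr0 rmorph_nat scaler_nat mulr2n.
by rewrite rnormZr// ler_pM2l.
Qed.

Lemma sqr_bounded (a w : 'L(H)) t : a^⋆ = a -> w^⋆ = w ->
  GRing.comm a w -> a * a + w * w = t%:I -> 0 <= t ->
  bounded_by (a * a) t.
Proof.
move=> asa wsa aw awt t0; have h := sqr_sum_bounded asa wsa aw awt t0.
rewrite -(sqr_sqrtr t0) expr2; exact: (bounded_byM (sqrtr_ge0 _) h h).
Qed.

End Roots.

(* For self-adjoint T this is the norm characterisation of T >= 0; unlike the
   form S^* S, it is visibly closed under sums. *)
Definition norm_positive (R : realType) (A : cstarAlgType R)
  (H : hilbertModType A) (T : 'L(H)) : Prop :=
  exists2 t : R, 0 <= t & bounded_by (t%:I - T) t.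

Section SquareRootUnique.
Context (R : realType) (A : cstarAlgType R) (H : hilbertModType A).
Implicit Types (x : H) (S T W G a c : 'L(H)) (r s q t : R).

Lemma bounded_by_gram T s : 0 <= s -> bounded_by (T^⋆ * T) s ->
  bounded_by T (2 * Num.sqrt s).
Proof.
move=> s0 Ts x; rewrite -(@ler_pXn2r _ 2) ?nnegrE ?rnorm_ge0//; last first.
  by rewrite !mulr_ge0 ?rnorm_ge0 ?sqrtr_ge0.
rewrite !exprMn sqr_sqrtr// -rnorm_inner_self adjointP.
rewrite (le_trans (rnorm_inner_le _ _))//.
have {}Ts : rnorm (T^⋆ (T x)) <= s * rnorm x := Ts x.
apply: (@le_trans _ _ (4 * rnorm x * (s * rnorm x))).
  by rewrite ler_wpM2l// mulr_ge0 ?rnorm_ge0.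
by rewrite le_eqVlt; apply/orP; left; apply/eqP; ring.
Qed.

Lemma bounded_by_adjoint T s : 0 <= s -> bounded_by T s ->
  bounded_by T^⋆ (4 * s).
Proof.
move=> s0 Ts x; have [->|z0] := eqVneq (rnorm (T^⋆ x)) 0.
  by rewrite !mulr_ge0 ?rnorm_ge0.
have zp : 0 < rnorm (T^⋆ x) by rewrite lt_def z0 rnorm_ge0.
rewrite -(ler_pM2r zp) -expr2 -rnorm_inner_self adjointP adjointK.
rewrite (le_trans (rnorm_inner_le _ _))//.
apply: (@le_trans _ _ (4 * rnorm x * (s * rnorm (T^⋆ x)))).
  by rewrite ler_wpM2l// mulr_ge0 ?rnorm_ge0.
by rewrite le_eqVlt; apply/orP; left; apply/eqP; ring.
Qed.

Lemma bounded_by_eq_gram S T s :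
  S^⋆ * S = T^⋆ * T -> bounded_by T s -> bounded_by S s.
Proof.
move=> ST Ts x; rewrite (@rnorm_eq_inner _ _ _ (S x) (T x)) ?Ts//.
by rewrite !adjointP -[S^⋆ (S x)]/((S^⋆ * S) x) ST.
Qed.

Lemma norm_positiveD S T :
  norm_positive S -> norm_positive T -> norm_positive (S + T).
Proof.
move=> [s s0 Ss] [t t0 Tt]; exists (s + t); first exact: addr_ge0.
rewrite scalar_opD (_ : _ - _ = (s%:I - S) + (t%:I - T)); last by ncring.
exact: bounded_byD.
Qed.

Lemma norm_positive_sqr a s : a^⋆ = a -> bounded_by a s ->
  norm_positive (a * a).
Proof.
move=> asa as_; have as2 := bounded_byW (ler_norm s) as_.
have aas : bounded_by (a * a) (`|s| * `|s|) by exact: bounded_byM.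
have s2 : 0 <= `|s| * `|s| < `|s| * `|s| + 1 by rewrite mulr_ge0// ltrDl ltr01.
have [|w [wsa wc ww]] := sqrt_exists _ s2 aas.
  by rewrite adjointM asa.
exists (`|s| * `|s| + 1); first by rewrite addr_ge0// mulr_ge0.
have t0 : 0 <= `|s| * `|s| + 1 by rewrite addr_ge0// mulr_ge0.
have aw : GRing.comm a w by apply: wc; exact: commrM.
rewrite -ww; apply: (sqr_bounded wsa asa (commr_sym aw) _ t0).
by rewrite ww subrK.
Qed.

Lemma norm_positiveN_eq0 G s : 0 <= s -> G * G = G + G ->
  norm_positive (- (s%:I * G)) -> s = 0 \/ G = 0.
Proof.
move=> s0 GG [t t0 Gt]; have [->|sn0] := eqVneq s 0; [by left|right].
apply: adjointable_ext => x; apply/eqP.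
rewrite -rnorm_eq0 eq_le rnorm_ge0 andbT.
have : rnorm (((t%:I - - (s%:I * G)) * G) x) <= t * rnorm (G x) := Gt (G x).
rewrite (_ : _ * G = (t + (s + s))%:I * G).
  have sp : 0 < s by rewrite lt_def sn0.
  rewrite scalar_opE rnormZr; last by lra.
  by have := rnorm_ge0 (G x); nra.
rewrite !scalar_opD (_ : _ * G = t%:I * G + s%:I * (G * G)); last by ncring.
by rewrite GG; ncring.
Qed.

(* The commutator d = S c - c S anticommutes with c = I + v, so that
   2 d = - (v d + d v) and |d| <= |v| |d|. *)
Lemma comm_of_comm_sqr c S q s : 0 <= q < 1 -> bounded_by (c - 1) q ->
  0 <= s -> bounded_by S s -> GRing.comm S (c * c) -> GRing.comm S c.
Proof.
move=> q01 cq s0 Ss Sc; have /andP[q0 q1] := q01.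
have q10 : 0 <= q + 1 by rewrite addr_ge0.
have cb : bounded_by c (q + 1).
  by rewrite -(subrK 1 c); apply: bounded_byD => //; exact: bounded_by1.
set d := S * c - c * S.
have dn : c * d = - (d * c).
  rewrite (_ : c * d = - (d * c) + (S * (c * c) - (c * c) * S)); last first.
    by rewrite /d; ncring.
  by rewrite Sc subrr addr0.
suff : d = 0 by move/eqP; rewrite subr_eq0 => /eqP.
have db : bounded_by d (s * (q + 1) + (q + 1) * s).
  by apply: bounded_byB; exact: bounded_byM.
apply: (bounded_by_eq0 q01 _ db) => [|r r0 dr].
  by rewrite addr_ge0// mulr_ge0.
have -> : d = (1 / 2)%:C *: - ((c - 1) * d + d * (c - 1)).
  rewrite (_ : - _ = d + d); first by rewrite half_add.
  rewrite (_ : - _ = - (c * d + d * c) + (d + d)); last by ncring.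
  by rewrite dn addNr oppr0 add0r.
rewrite (_ : q * r = 1 / 2 * (q * r + r * q)); last by field.
apply: bounded_byZ; first by lra.
by apply: bounded_byN; apply: bounded_byD; exact: bounded_byM.
Qed.

(* F = c^-1 S is a symmetry; let G = I - F, twice its projection onto the
   eigenvalue -1. Then Y = W c^(-1/2) G satisfies Y^* Y = - 2 G, and K = Y Y^*
   satisfies K^2 = - 4 K. Writing 2 (Y^* Y + Y Y^* ) as the sum of the squares of
   Y + Y^* and i (Y - Y^* ) exhibits - 8 G as a sum of squares, so G = 0. *)
Lemma positive_sqrt_unique c S W q : c^⋆ = c -> 0 <= q < 1 ->
  bounded_by (c - 1) q -> S = W^⋆ * W -> S * S = c * c -> S = c.
Proof.
move=> csa q01 cq SW SS; have /andP[q0 q1] := q01.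
have q10 : 0 <= q + 1 by rewrite addr_ge0.
have ysa : (1 - c)^⋆ = 1 - c by rewrite adjointD adjointN adjoint1 csa.
have yq : bounded_by (1 - c) q by rewrite -opprB; exact: bounded_byN.
have [D [Dsa Dy DD]] := sqrt1_exists ysa q01 yq.
have [ci [cisa cib ciy cic]] := inverse1_exists ysa q01 yq.
rewrite subKr in DD cic.
have commy b : GRing.comm b c -> GRing.comm b (1 - c).
  by apply: commrB; exact: commr1.
have Ssa : S^⋆ = S by rewrite SW adjointM adjointK.
have cb : bounded_by c (q + 1).
  by rewrite -(subrK 1 c); apply: bounded_byD => //; exact: bounded_by1.
have Sb : bounded_by S (q + 1).
  by apply: bounded_by_eq_gram cb; rewrite Ssa csa.
have Wb : bounded_by W (2 * Num.sqrt (q + 1)).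
  by apply: bounded_by_gram => //; rewrite -SW.
have Db : bounded_by D (2 * Num.sqrt (q + 1)).
  by apply: bounded_by_gram => //; rewrite Dsa DD.
have Sc : GRing.comm S c.
  by apply: (comm_of_comm_sqr q01 cq q10 Sb); rewrite -SS; exact: commrM.
have SD : GRing.comm S D by apply: Dy; exact: commy.
have Sci : GRing.comm S ci by apply: ciy; exact: commy.
have cci : GRing.comm c ci by apply: ciy; exact: commy.
have ciC : c * ci = 1 by rewrite cci.
pose F := ci * S.
have FF : F * F = 1.
  by rewrite /F mulrA -(mulrA ci S) Sci mulrA -mulrA SS mulrA -(mulrA ci ci) cic mulr1.
pose G := 1 - F.
have FE : F = 1 - G by rewrite subKr.
have GG : G * G = G + G.
  rewrite /G (_ : _ * _ = 1 - (F + F) + F * F); last by ncring.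
  by rewrite FF; ncring.
have Gsa : G^⋆ = G.
  by rewrite adjointD adjointN adjoint1 adjointM cisa Ssa Sci.
pose Y := W * (D * ci * G).
have Ysa : Y^⋆ = G * ci * D * W^⋆.
  by rewrite !adjointM Gsa cisa Dsa !mulrA.
have YY : Y^⋆ * Y = - (G + G).
  rewrite Ysa (_ : _ * Y = G * (ci * D * (W^⋆ * W) * D * ci) * G).
    rewrite -SW (_ : ci * D * S * D * ci = F); last first.
      rewrite (_ : _ * ci = ci * (D * S) * D * ci); last by ncring.
      rewrite -SD (_ : _ * ci = F * ((D * D) * ci)); last by rewrite /F; ncring.
      by rewrite DD ciC mulr1.
    rewrite FE (_ : _ * _ = G * G - G * G * G); last by ncring.
    by rewrite GG mulrDl GG; ncring.
  by rewrite /Y; ncring.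
have YG : Y * G = Y + Y.
  rewrite (_ : Y * G = W * (D * ci * (G * G))); last by rewrite /Y; ncring.
  by rewrite GG /Y; ncring.
pose K := Y * Y^⋆.
have KK : K * K = - (K + K + (K + K)).
  rewrite (_ : K * K = Y * (Y^⋆ * Y) * Y^⋆); last by rewrite /K; ncring.
  rewrite YY (_ : _ * Y^⋆ = - (Y * G + Y * G) * Y^⋆); last by ncring.
  by rewrite YG /K; ncring.
have Yb : exists2 s, 0 <= s & bounded_by Y s.
  have w0 : 0 <= 2 * Num.sqrt (q + 1) by rewrite mulr_ge0 ?sqrtr_ge0.
  have e0 : 0 <= 1 / (1 - q) by rewrite div1r invr_ge0 subr_ge0 ltW.
  have Gb : bounded_by G (1 + 1 / (1 - q) * (q + 1)).
    by apply: bounded_byB; [exact: bounded_by1|exact: bounded_byM].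
  have De := bounded_byM w0 Db cib.
  have DG := bounded_byM (mulr_ge0 w0 e0) De Gb.
  exists (2 * Num.sqrt (q + 1) * (2 * Num.sqrt (q + 1) * (1 / (1 - q)) *
                                    (1 + 1 / (1 - q) * (q + 1)))).
    by rewrite (mulr_ge0 w0)// (mulr_ge0 (mulr_ge0 w0 e0))// addr_ge0// (mulr_ge0 e0).
  exact: bounded_byM.
have [s s0 {}Yb] := Yb; have Ysb := bounded_by_adjoint s0 Yb.
pose p := Y + Y^⋆; pose r := imagC *: (Y - Y^⋆).
have psa : p^⋆ = p by rewrite adjointD adjointK addrC.
have rsa : r^⋆ = r.
  by rewrite adjointZ adjointD adjointN adjointK imagC_conj scaleNr -scalerN opprB.
have Ksa : K^⋆ = K by rewrite adjointM adjointK.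
have rr : r * r = - ((Y - Y^⋆) * (Y - Y^⋆)).
  by rewrite acomp_scalel acomp_scaler scalerA imagC_sqr scaleN1r.
have pp : norm_positive (p * p).
  by apply: norm_positive_sqr psa _; exact: (bounded_byD Yb Ysb).
have rp : norm_positive (r * r).
  apply: (norm_positive_sqr (s := s + 4 * s) rsa) => x.
  rewrite [rnorm _]rnorm_imagCZ.
  exact: (bounded_byB Yb Ysb).
have Kp : norm_positive (K * K).
  by apply: norm_positive_sqr Ksa _; exact: (bounded_byM s0 Yb Ysb).
suff G0 : G = 0.
  have F1 : F = 1 by rewrite FE G0 subr0.
  by rewrite -[S]mul1r -ciC -mulrA -/F F1 mulr1.
have [||/eqP|//] := @norm_positiveN_eq0 G 8 _ GG.
- by [].
- rewrite (_ : - _ = p * p + p * p + (r * r + r * r) + K * K).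
    by do ?apply: norm_positiveD.
  rewrite (_ : 8 = (1 + 1) * (1 + 1) * (1 + 1)); last by ring.
  rewrite !scalar_opM !scalar_opD !scalar_op1 KK rr /p /K.
  rewrite (_ : - _ = (1+1) * ((1+1) * (- (G + G)))); last by ncring.
  by rewrite -YY; ncring.
- by rewrite pnatr_eq0.
Qed.

End SquareRootUnique.

Section QuasiProjectionPair.
Context (R : realType) (A : cstarAlgType R) (H : hilbertModType A).
Implicit Types (x : H) (P Q J T N : 'L(H)) (r q t : R).

Lemma opnorm_ltP T r : (opnorm T < r%:E)%E ->
  exists2 s, 0 <= s < r & bounded_by T s.
Proof.
move=> Tr; pose S := [set (rnorm (T x))%:E | x in [set x : H | `|x| <= 1]].
have TS x : rnorm x <= 1 -> ((rnorm (T x))%:E <= opnorm T)%E.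
  move=> x1; apply: ereal_sup_ubound; exists x => //=.
  by rewrite rnormE -[1]/(1%:C) lecR.
have T0 : (0 <= opnorm T)%E.
  by apply: le_trans (TS 0 _); rewrite ?rnorm0// lee_fin rnorm_ge0.
have Tfin : opnorm T \is a fin_num.
  by rewrite ge0_fin_numE// (lt_le_trans Tr)// leey.
move: T0 Tr TS; rewrite -(fineK Tfin) lee_fin lte_fin.
set s := fine _ => s0 sr TS; exists s; first by rewrite s0.
move=> x; have [->|x0] := eqVneq x 0; first by rewrite aop0 !rnorm0 mulr0.
have xp : 0 < rnorm x by rewrite lt_def rnorm_eq0 x0 rnorm_ge0.
have := TS ((rnorm x)^-1%:C *: x).
rewrite aopZ !rnormZr ?invr_ge0 ?rnorm_ge0// mulVf ?gt_eqF// => /(_ (lexx _)).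
by rewrite lee_fin mulrC ler_pdivrMr.
Qed.

Lemma opnorm_le T s : 0 <= s -> bounded_by T s -> (opnorm T <= s%:E)%E.
Proof.
move=> s0 Ts; apply: ge_ereal_sup => _ [x /= x1 <-]; rewrite lee_fin.
rewrite (le_trans (Ts x))// ler_piMr// -lecR -rnormE.
exact: x1.
Qed.

(* With J = 2P - I the three block identities say that Q^* = J Q J. *)
Lemma quasi_projection_symmetry P Q : quasi_projection_pair P Q ->
  Q^⋆ = (P + P - 1) * Q * (P + P - 1).
Proof.
move=> [[_ Psa] _ h1 h2 h3].
have {}h1 : P * Q^⋆ * P = P * Q * P := h1.
have {}h2 : P * Q^⋆ * (1 - P) = - (P * Q * (1 - P)) := h2.
have {}h3 : (1 - P) * Q^⋆ * (1 - P) = (1 - P) * Q * (1 - P) := h3.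
have h4 : (1 - P) * Q^⋆ * P = - ((1 - P) * Q * P).
  have := congr1 (@adjoint R A H H) h2.
  rewrite adjointN !adjointM adjointK adjointD adjointN adjoint1 Psa !mulrA.
  by move=> ->; rewrite opprK.
rewrite (_ : Q^⋆ = P * Q^⋆ * P + P * Q^⋆ * (1 - P) + (1 - P) * Q^⋆ * P
  + (1 - P) * Q^⋆ * (1 - P)); last by ncring.
by rewrite h1 h2 h3 h4; ncring.
Qed.

(* N = I - T and N' = I - T^-1, where T = JE is self-adjoint with inverse
   J T J. In spectral terms, T ranges over ]-1, 3[ and so does T^-1, which
   leaves ]1/3, 3[. With t > |N| the element (t + N) (t + N') is a square k^2,
   N + N' is minus a square z^2, and k^2 + (t + 1) z^2 = t^2 bounds z^2. *)
Lemma inverse_pair_bound J N N' r : J^⋆ = J -> J * J = 1 -> N^⋆ = N ->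
    N' = J * N * J -> N * N' = N + N' -> N' * N = N + N' ->
    0 <= r < 1 -> bounded_by N (2 * r) ->
  exists2 q, 0 <= q < 2 / 3 & bounded_by (N + N') (2 * q).
Proof.
move=> Jsa JJ Nsa N'E NN' N'N /andP[r0 r1] Nb.
have N'sa : N'^⋆ = N' by rewrite N'E !adjointM Jsa Nsa mulrA.
have Jb : bounded_by J 1.
  apply: bounded_by_eq_gram (@bounded_by1 _ _ H).
  by rewrite Jsa JJ adjoint1 mulr1.
have r20 : 0 <= 2 * r by rewrite mulr_ge0.
have N'b : bounded_by N' (2 * r).
  rewrite N'E -[2 * r]mul1r -[_ * (2 * r)]mulr1.
  by apply: bounded_byM; [rewrite mul1r|exact: bounded_byM|].
have Ncom : GRing.comm N N' by rewrite /GRing.comm NN' N'N.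
set X := N + N'.
have Xsa : X^⋆ = X by rewrite adjointD Nsa N'sa.
have Xb : bounded_by X (4 * r).
  by rewrite (_ : 4 * r = 2 * r + 2 * r); [exact: bounded_byD|ring].
pose t := r + 1.
have [|||f [fsa fc ff]] := @sqrt_exists _ _ _ (- N) (2 * r) t.
- by rewrite adjointN Nsa.
- by rewrite r20 /t; lra.
- exact: bounded_byN.
rewrite opprK in ff.
pose f' := J * f * J.
have f'sa : f'^⋆ = f' by rewrite !adjointM Jsa fsa mulrA.
have ff' : f' * f' = t%:I + N'.
  rewrite (_ : f' * f' = J * f * (J * J) * f * J); last by rewrite /f'; ncring.
  rewrite JJ (_ : _ * J = J * (f * f) * J); last by ncring.
  rewrite ff (_ : _ * J = J * t%:I * J + J * N * J); last by ncring.
  by rewrite -N'E comm_scalar_op -mulrA JJ mulr1.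
have JN' : J * N' = N * J by rewrite N'E !mulrA JJ mul1r.
have N'J : N' * J = J * N by rewrite N'E -mulrA JJ mulr1.
have JN : J * N = N' * J by [].
have fN : GRing.comm f N by apply/commr_sym/fc/commrN.
have fN' : GRing.comm f N' by apply/commr_sym/fc/commrN/commr_sym.
have f'N : GRing.comm f' N.
  rewrite /GRing.comm /f' -mulrA JN (_ : _ * (_ * J) = J * (f * N') * J).
    rewrite fN' (_ : _ * J = J * N' * f * J); last by ncring.
    by rewrite JN'; ncring.
  by ncring.
have f'N' : GRing.comm f' N'.
  rewrite /GRing.comm /f' -mulrA JN' (_ : _ * (_ * J) = J * (f * N) * J).
    rewrite fN (_ : _ * J = J * N * f * J); last by ncring.
    by rewrite JN; ncring.
  by ncring.
have fcf' : GRing.comm f f' by apply/commr_sym/fc/commrN.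
pose k := f * f'.
have ksa : k^⋆ = k by rewrite adjointM fsa f'sa -fcf'.
have kN : GRing.comm k N by apply/commr_sym/commrM; exact/commr_sym.
have kN' : GRing.comm k N' by apply/commr_sym/commrM; exact/commr_sym.
have kk : k * k = (t * t)%:I + (t + 1)%:I * X.
  rewrite (_ : k * k = f * (f' * f) * f'); last by rewrite /k; ncring.
  rewrite -fcf' (_ : _ * f' = (f * f) * (f' * f')); last by ncring.
  rewrite ff ff' scalar_opM scalar_opD scalar_op1.
  rewrite (_ : _ * _ = t%:I * t%:I + t%:I * N' + N * t%:I + N * N').
    by rewrite comm_scalar_op NN' /X; ncring.
  by ncring.
have X4 : 0 <= 4 * r < 4 by rewrite mulr_ge0//=; lra.
have [g [gsa gc gg]] := sqrt_exists Xsa X4 Xb.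
have [e [esa ec ee]] := inverse_exists Xsa X4 Xb.
have NX : GRing.comm N X by apply: commrD.
have N'X : GRing.comm N' X by apply: commrD => //; exact: commr_sym.
pose s := N' - N.
have ssa : s^⋆ = s by rewrite adjointD adjointN Nsa N'sa.
have comms b : GRing.comm b N -> GRing.comm b N' ->
    [/\ GRing.comm b s, GRing.comm b g & GRing.comm b e].
  move=> bN bN'; have bX : GRing.comm b X by apply: commrD.
  by split; [exact: commrB|exact: gc|exact: ec].
have [_ Ng Ne] := comms N (commr_refl _) Ncom.
have [_ N'g N'e] := comms N' (commr_sym Ncom) (commr_refl _).
have gN := commr_sym Ng; have gN' := commr_sym N'g.
have eN := commr_sym Ne; have eN' := commr_sym N'e.
have [gs _ ge] := comms g gN gN'.
have [es _ _] := comms e eN eN'.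
pose z := s * g * e.
have zsa : z^⋆ = z.
  rewrite !adjointM ssa gsa esa /z gs (mulrA e).
  by rewrite -(mulrA s) ge (mulrA s) -es -mulrA -gs mulrA.
have ss : s * s = X * X - (X + X + (X + X)).
  rewrite (_ : s * s = X * X - (N * N' + N' * N + (N * N' + N' * N))).
    by rewrite NN' N'N; rewrite /X; ncring.
  by rewrite /s /X; ncring.
have zz : z * z = - X.
  have sge : GRing.comm (g * e) s.
    by apply/commr_sym/commrM; exact/commr_sym.
  have gege : g * e * (g * e) = e.
    rewrite (_ : _ * _ = g * (e * g) * e); last by ncring.
    rewrite -ge (_ : _ * e = (g * g) * e * e); last by ncring.
    rewrite gg -(_ : GRing.comm e (4%:I - X)) ?ee ?mul1r//.
    by apply/commrB; [exact: comm_scalar_op|exact/commr_sym/ec].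
  rewrite (_ : z * z = s * ((g * e) * s) * (g * e)); last by rewrite /z; ncring.
  rewrite sge (_ : _ * (g * e) = (s * s) * (g * e * (g * e))); last by ncring.
  rewrite gege ss (_ : X * X - _ = - X * (4%:I - X)).
    rewrite -mulrA -(_ : GRing.comm e (4%:I - X)) ?ee ?mulr1//.
    by apply/commrB; [exact: comm_scalar_op|exact/commr_sym/ec].
  rewrite mulrBr comm_scalar_op (_ : 4 = (1 + 1) + (1 + 1)); last by ring.
  by rewrite !scalar_opD scalar_op1; ncring.
have t10 : 0 < t + 1 by rewrite /t; lra.
pose z1 := (Num.sqrt (t + 1))%:I * z.
have z1sa : z1^⋆ = z1 by rewrite adjointM adjoint_scalar_op zsa comm_scalar_op.
have kz1 : GRing.comm z1 k.
  have [ks kg ke] := comms k kN kN'.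
  apply/commr_sym; rewrite /z1; apply: commrM; first exact: comm_scalar_op.
  by rewrite /z; apply: commrM => //; exact: commrM.
have z1z1 : z1 * z1 = (t + 1)%:I * (z * z).
  rewrite -(sqr_sqrtr (ltW t10)) expr2 scalar_opM.
  rewrite (_ : z1 * z1 = (Num.sqrt (t + 1))%:I * (z * (Num.sqrt (t + 1))%:I) * z).
    by rewrite comm_scalar_op; ncring.
  by rewrite /z1; ncring.
have z1k : z1 * z1 + k * k = (t * t)%:I by rewrite z1z1 zz kk; ncring.
have tt0 : 0 <= t * t by rewrite mulr_ge0// /t; lra.
have z1b := sqr_bounded z1sa ksa kz1 z1k tt0.
exists (t * t / (2 * (t + 1))).
  have t2 : 0 < 2 * (t + 1) by rewrite mulr_gt0.
  apply/andP; split; first by rewrite divr_ge0// ltW.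
  by rewrite ltr_pdivrMr// /t; nra.
have -> : X = - ((t + 1)^-1%:C *: (z1 * z1)).
  rewrite z1z1 zz scalar_opE scalerA -rmorphM /= mulVf ?gt_eqF// scale1r.
  by rewrite opprK.
apply: bounded_byN; rewrite (_ : 2 * _ = (t + 1)^-1 * (t * t)).
  by apply: bounded_byZ z1b; rewrite invr_ge0 ltW.
by field; rewrite gt_eqF.
Qed.

Lemma quasi_projection_structure P Q r : quasi_projection_pair P Q ->
    0 <= r < 1 -> bounded_by (P - Q) r ->
  exists (c : 'L(H)) q,
    [/\ c^⋆ = c, 0 <= q < 2 / 3, bounded_by (c - 1) q,
        c * (P + P - 1) = Q + Q^⋆ - 1 &
        [/\ GRing.comm c P, GRing.comm c Q & GRing.comm c Q^⋆]].
Proof.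
move=> hPQ r01 PQr; have := quasi_projection_symmetry hPQ.
have [[PP Psa] QQ _ _ _] := hPQ.
have {}PP : P * P = P := PP.
have {}QQ : Q * Q = Q := QQ.
set J := P + P - 1 => QJ.
have JJ : J * J = 1.
  rewrite (_ : J * J = (P * P + P * P) + (P * P + P * P) - (P + P + P + P) + 1).
    by rewrite PP; ncring.
  by rewrite /J; ncring.
have Jsa : J^⋆ = J by rewrite !adjointD adjointN adjoint1 Psa.
pose E := Q + Q - 1.
have EE : E * E = 1.
  rewrite (_ : E * E = (Q * Q + Q * Q) + (Q * Q + Q * Q) - (Q + Q + Q + Q) + 1).
    by rewrite QQ; ncring.
  by rewrite /E; ncring.
have EJ : J * E * J = Q^⋆ + Q^⋆ - 1.
  rewrite QJ (_ : J * E * J = J * Q * J + J * Q * J - J * J); first by rewrite JJ.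
  by rewrite /E; ncring.
have Esa : E^⋆ = J * E * J by rewrite EJ !adjointD adjointN adjoint1.
pose N := 1 - J * E; pose N' := 1 - E * J.
have N'E : N' = J * N * J.
  rewrite (_ : J * N * J = J * J - J * J * E * J); first by rewrite JJ mul1r.
  by rewrite /N; ncring.
have Nsa : N^⋆ = N.
  rewrite adjointD adjointN adjoint1 adjointM Esa Jsa.
  by rewrite -mulrA JJ mulr1.
have NN' : N * N' = N + N'.
  rewrite (_ : N * N' = 1 - J * E - E * J + J * (E * E) * J).
    by rewrite EE mulr1 JJ /N /N'; ncring.
  by rewrite /N /N'; ncring.
have N'N : N' * N = N + N'.
  rewrite (_ : N' * N = 1 - J * E - E * J + E * (J * J) * E).
    by rewrite JJ mulr1 EE /N /N'; ncring.
  by rewrite /N /N'; ncring.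
have Jb : bounded_by J 1.
  apply: bounded_by_eq_gram (@bounded_by1 _ _ H).
  by rewrite Jsa JJ adjoint1 mulr1.
have Nb : bounded_by N (2 * r).
  rewrite (_ : 2 * r = 1 * r + 1 * r); last by ring.
  rewrite (_ : N = J * (P - Q) + J * (P - Q)).
    by apply: bounded_byD; exact: bounded_byM.
  by rewrite /N -JJ /E /J; ncring.
have [q q01 Xb] := inverse_pair_bound Jsa JJ Nsa N'E NN' N'N r01 Nb.
have q0 : 0 <= q by case/andP: q01.
pose X := N + N'.
have XJ : X * J = J + J - (J * E * J + E).
  rewrite (_ : X * J = J + J - (J * E * J + E * (J * J))); first by rewrite JJ mulr1.
  by rewrite /X /N /N'; ncring.
have JX : J * X = J + J - (J * E * J + E).
  rewrite (_ : J * X = J + J - (J * E * J + J * J * E)); first by rewrite JJ mul1r.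
  by rewrite /X /N /N'; ncring.
have XE : X * E = E * X.
  rewrite (_ : X * E = E + E - (J * (E * E) + E * J * E)).
    rewrite (_ : E * X = E + E - (E * E * J + E * J * E));
      first by rewrite EE mulr1 mul1r.
    by rewrite /X /N /N'; ncring.
  by rewrite /X /N /N'; ncring.
pose c := 1 - (1 / 2)%:C *: X.
have ccom b : GRing.comm X (b + b - 1) -> GRing.comm c b.
  move=> Xb'; apply/commr_sym; apply: commrB; first exact: commr1.
  apply: commrZ; rewrite -(half_add b); apply/commr_sym; apply: commrZ.
  by rewrite -(subrK 1 (b + b)); apply: commrD => //; exact: commr1.
have cP : GRing.comm c P by apply: ccom; rewrite /GRing.comm XJ JX.
have cQ : GRing.comm c Q by apply: ccom.
have csa : c^⋆ = c.
  have N'sa : N'^⋆ = N' by rewrite N'E !adjointM Jsa Nsa mulrA.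
  by rewrite adjointD adjointN adjoint1 adjointZr adjointD Nsa N'sa.
exists c, q; split => //.
- rewrite /c addrC addKr; apply: bounded_byN.
  rewrite (_ : q = 1 / 2 * (2 * q)); last by field.
  by apply: bounded_byZ Xb.
- rewrite mulrBl [1 * J]mul1r acomp_scalel XJ EJ.
  pose L := J - (Q + Q^⋆ - 1).
  have -> : J + J - (Q^⋆ + Q^⋆ - 1 + E) = L + L by rewrite /L /E; ncring.
  by rewrite half_add /L subKr.
- split => //; have := congr1 (@adjoint R A H H) cQ.
  by rewrite !adjointM csa => /esym.
Qed.

End QuasiProjectionPair.

Section Compression.
Context (R : realType) (A : cstarAlgType R) (H : hilbertModType A).
Context (M : submodule H) (p : 'L(H)) (psa : p^⋆ = p)
  (p_in : forall x, subm_set M (p x))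
  (p_id : forall x, subm_set M x -> p x = x).

Definition subm_proj (x : H) : subm_type M := SubmType (asboolT (p_in x)).

Lemma subm_projP (x : subm_type M) (y : H) :
  inner (submval x) y = inner x (subm_proj y) :> A.
Proof.
rewrite -[RHS]/(inner (submval x) (p y)) -{1}psa -adjointP p_id//.
exact/asboolP/submvalP.
Qed.

Definition subm_incl : 'L(subm_type M, H) := Adjointable subm_projP.

Definition extend (S : 'L(subm_type M)) : 'L(H) :=
  subm_incl ** S ** subm_incl^⋆.

Definition compress (S : 'L(H)) : 'L(subm_type M) :=
  subm_incl^⋆ ** S ** subm_incl.

Lemma subm_inclK : subm_incl^⋆ ** subm_incl = aid.
Proof.
apply: adjointable_ext => x; apply: val_inj => /=.
by rewrite p_id//; exact/asboolP/submvalP.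
Qed.

Lemma extend_compress S : extend (compress S) = p * S * p.
Proof. exact: adjointable_ext. Qed.

Lemma extendK S : compress (extend S) = S.
Proof.
have E x : subm_incl^⋆ (subm_incl x) = x :> subm_type M.
  by rewrite -[LHS]/((subm_incl^⋆ ** subm_incl) x) subm_inclK.
apply: adjointable_ext => x.
by rewrite -[LHS]/(subm_incl^⋆ (subm_incl (S (subm_incl^⋆ (subm_incl x))))) !E.
Qed.

Lemma extendM S T : extend (S ** T) = extend S * extend T.
Proof.
apply: adjointable_ext => x.
rewrite -[RHS]/(subm_incl (S ((subm_incl^⋆ ** subm_incl) (T (subm_incl^⋆ x))))).
by rewrite subm_inclK.
Qed.

Lemma extendD S T : extend (S + T) = extend S + extend T.
Proof. exact: adjointable_ext. Qed.

Lemma extend1 : extend aid = p.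
Proof. exact: adjointable_ext. Qed.

Lemma extend_adjoint S : extend S^⋆ = (extend S)^⋆.
Proof. exact: adjointable_ext. Qed.

Lemma extend_inj : injective extend.
Proof. exact: can_inj extendK. Qed.

End Compression.

Section Matched.
Context (R : realType) (A : cstarAlgType R) (H : hilbertModType A).
Implicit Types (P Q c p S T : 'L(H)).

Lemma proj_range_eq Q p : p^⋆ = p -> p * Q = Q -> Q * p = p ->
  proj_range Q = p.
Proof.
move=> psa pQ Qp.
have rp : range p = range Q.
  apply/seteqP; split=> _ [x _ <-].
    by exists (p x) => //; rewrite -[LHS]/((Q * p) x) Qp.
  by exists (Q x) => //; rewrite -[LHS]/((p * Q) x) pQ.
have pp : p * p = p by rewrite -{2}Qp mulrA pQ Qp.
apply: xget_unique; first by split; [split|].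
move=> p' [[p'p' p'sa]]; rewrite -rp => rp'.
have fixp (a b : 'L(H)) : range a = range b -> b * b = b -> b * a = a.
  move=> ab bb; apply: adjointable_ext => x.
  have [y _ yE] : range b (a x) by rewrite -ab; exists x.
  by rewrite -[LHS]/(b (a x)) -yE -[LHS]/((b * b) y) bb.
have p'p : p' * p = p by apply: fixp.
have pp' : p * p' = p' by apply: fixp.
by rewrite -p'sa -pp' adjointM psa p'sa.
Qed.

Lemma ainv_eq (H1 H2 : innerModType A) (S : 'L(H1, H2)) (T : 'L(H2, H1)) :
  T ** S = aid -> S ** T = aid -> ainv S = T.
Proof.
move=> TS ST; apply: xget_unique => // T' [_ ST'].
apply: adjointable_ext => x.
by rewrite -[LHS]/(aid (T' x)) -TS -[LHS]/(T ((S ** T') x)) ST'.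
Qed.

Context (Q c D ci e : 'L(H)) (q : R).
Context (QQ : Q * Q = Q) (csa : c^⋆ = c) (q01 : 0 <= q < 1)
  (cq : bounded_by (c - 1) q) (QcQ : Q * Q^⋆ * Q = c * c * Q)
  (cQ : GRing.comm c Q) (cQ' : GRing.comm c Q^⋆) (Dsa : D^⋆ = D)
  (DD : D * D = c) (cisa : ci^⋆ = ci) (cic : ci * c = 1)
  (ec : e * (c + 1) = 1)
  (comm_roots : forall b, GRing.comm b c ->
    [/\ GRing.comm b D, GRing.comm b ci & GRing.comm b e]).

Let p := Q * Q^⋆ * (ci * ci).

Let ciQ : GRing.comm Q ci. Proof. by case: (comm_roots (commr_sym cQ)). Qed.
Let ciQ' : GRing.comm Q^⋆ ci. Proof. by case: (comm_roots (commr_sym cQ')). Qed.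
Let cci : c * ci = 1.
Proof. by have [_ -> _] := comm_roots (commr_refl c). Qed.
Let ce : (c + 1) * e = 1.
Proof.
have [_ _ h] := comm_roots (commr_refl c).
by rewrite -[RHS]ec mulrDl mulrDr mulr1 mul1r h.
Qed.

Let commp b : GRing.comm b Q -> GRing.comm b Q^⋆ -> GRing.comm b ci ->
  GRing.comm b p.
Proof. by move=> h1 h2 h3; do 2 apply: commrM => //; exact: commrM. Qed.

Let cp : GRing.comm c p.
Proof. by apply: commp => //; rewrite /GRing.comm cci. Qed.
Let cip : GRing.comm p ci.
Proof. by have [] := comm_roots (commr_sym cp). Qed.
Let Dp : GRing.comm p D.
Proof. by have [] := comm_roots (commr_sym cp). Qed.
Let ep : GRing.comm p e.
Proof. by have [] := comm_roots (commr_sym cp). Qed.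

Let psa : p^⋆ = p.
Proof.
rewrite /p !adjointM cisa adjointK.
have h : GRing.comm (Q * Q^⋆) ci.
  by apply/commr_sym/commrM; exact/commr_sym.
by rewrite mulrA -mulrA -(mulrA ci) -h mulrA -h -!mulrA.
Qed.

Let pQ : p * Q = Q.
Proof.
rewrite /p (_ : _ * Q = Q * Q^⋆ * (ci * (ci * Q))); last by ncring.
rewrite -ciQ (mulrA ci) -ciQ (_ : _ * _ = Q * Q^⋆ * Q * (ci * ci)).
  rewrite QcQ (_ : _ * _ = c * (c * Q) * (ci * ci)); last by ncring.
  rewrite cQ (_ : _ * _ = (c * Q) * (c * ci) * ci); last by ncring.
  by rewrite cci cQ mulr1 -mulrA cci mulr1.
by ncring.
Qed.

Let Qp : Q * p = p.
Proof. by rewrite /p !mulrA QQ. Qed.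

Let pp : p * p = p.
Proof. by rewrite -{2}Qp mulrA pQ Qp. Qed.

Let Q'p : Q^⋆ * p = Q^⋆.
Proof. by rewrite -[in RHS]pQ adjointM psa. Qed.

Let pQ' : p * Q^⋆ = p.
Proof. by rewrite -[in RHS]psa -[in RHS]Qp adjointM psa. Qed.

Let ccp : c * c * p = Q * Q^⋆.
Proof.
rewrite -mulrA cp (_ : _ * _ = (c * p) * c); last by ncring.
rewrite cp /p (_ : _ * c * c = Q * Q^⋆ * (ci * (ci * c) * c)); last by ncring.
by rewrite cic mulr1 cic mulr1.
Qed.

Lemma idempotent_norm_bound r : 0 <= r -> bounded_by c r -> bounded_by Q r.
Proof.
move=> r0 cr; pose f := Q^⋆ * Q * (ci * ci).
have cciQ : GRing.comm (Q^⋆ * Q) ci.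
  by apply/commr_sym/commrM; exact/commr_sym.
have cQQ : GRing.comm c (Q^⋆ * Q) by exact: commrM.
have fsa : f^⋆ = f.
  rewrite /f !adjointM cisa adjointK.
  by rewrite mulrA -mulrA -(mulrA ci) -cciQ mulrA -cciQ -!mulrA.
have fE : c * c * f = Q^⋆ * Q.
  rewrite /f (_ : _ * _ = c * (c * (Q^⋆ * Q)) * ci * ci); last by ncring.
  rewrite cQQ (_ : _ * ci * ci = c * (Q^⋆ * Q) * (c * ci) * ci); last by ncring.
  by rewrite cci cQQ mulr1 -mulrA cci mulr1.
have cf : GRing.comm c f.
  by apply: commrM => //; apply: commrM; rewrite /GRing.comm cci cic.
have ff : f * f = f.
  rewrite {1}/f (_ : _ * f = Q^⋆ * Q * (ci * (ci * f))); last by ncring.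
  have cif : GRing.comm f ci by have [] := comm_roots (commr_sym cf).
  rewrite -cif (mulrA ci) -cif {1}/f.
  rewrite (_ : _ * _ = Q^⋆ * (Q * Q^⋆ * Q) * (ci * ci) * (ci * ci)).
    rewrite QcQ (_ : _ * _ = Q^⋆ * (c * c) * Q * (ci * ci) * (ci * ci)).
      rewrite -(_ : GRing.comm (c * c) Q^⋆); last first.
        by apply/commr_sym/commrM; exact/commr_sym.
      rewrite (_ : _ * _ = c * c * f * (ci * ci)); last by rewrite /f; ncring.
      by rewrite fE.
    by ncring.
  by rewrite /f; ncring.
have fb : bounded_by f 1.
  rewrite -[1]sqrtr1; apply: (@sqr_sum_bounded _ _ _ f (1 - f)) => //.
  - by rewrite adjointD adjointN adjoint1 fsa.
  - by apply: commrB; [exact: commr1|exact: commr_refl].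
  - rewrite scalar_op1 (_ : _ + (1 - f) * _ = 1 - (f + f) + (f * f + f * f)).
      by rewrite ff; ncring.
    by ncring.
apply: (@bounded_by_eq_gram _ _ _ _ (c * f)).
  rewrite adjointM csa fsa -cf (_ : c * f * _ = c * (f * c) * f); last by ncring.
  rewrite -cf (_ : c * _ * f = c * c * (f * f)); last by ncring.
  by rewrite ff fE.
by rewrite -[r]mulr1; exact: bounded_byM.
Qed.

Let p' : 'L(H) := 1 - p.

Let p'sa : p'^⋆ = p'.
Proof. by rewrite adjointD adjointN adjoint1 psa. Qed.

Let p_in x : subm_set (range_sub Q) (p x).
Proof. by exists (p x) => //; rewrite -[LHS]/((Q * p) x) Qp. Qed.

Let p_id x : subm_set (range_sub Q) x -> p x = x.
Proof. by move=> [y _ <-]; rewrite -[LHS]/((p * Q) y) pQ. Qed.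

Let p'_in x : subm_set (null_sub Q^⋆) (p' x).
Proof. by rewrite /= -[LHS]/((Q^⋆ * p') x) mulrBr mulr1 Q'p subrr. Qed.

Let p'_id x : subm_set (null_sub Q^⋆) x -> p' x = x.
Proof.
move=> x0; have {}x0 : Q^⋆ x = 0 := x0.
have px : p x = p (Q^⋆ x) by rewrite -[RHS]/((p * Q^⋆) x) pQ'.
by rewrite -[LHS]/(x - p x) px x0 aop0 subr0.
Qed.

Let V := subm_incl psa p_in p_id.
Let W := subm_incl p'sa p'_in p'_id.

Let proj_rangeQ : proj_range Q = p.
Proof. exact: proj_range_eq. Qed.

Let U : 'L(H, ('R(Q) * 'N(Q^⋆))%type).
Proof.
exists (fun h => (V^⋆ h, W^⋆ h)) (fun y => V y.1 + W y.2) => x y.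
abstract by rewrite -[LHS]/(inner (V^⋆ x) y.1 + inner (W^⋆ x) y.2) innerDr
  !adjointP !adjointK.
Defined.

Let mp_UE : mp_U Q = U.
Proof.
apply: xget_unique => [h|U' U'P]; first by rewrite proj_rangeQ.
apply: adjointable_ext => h; have := U'P h; case: (U' h) => u v [/= hu hv].
by congr pair; apply: val_inj; rewrite /= ?hu ?hv proj_rangeQ.
Qed.

Let T : 'L('N(Q^⋆), 'R(Q)) := V^⋆ ** (Q - p) ** W.

Let mp_AE : mp_A Q = T.
Proof.
have TE x : submval (T x) = (Q - proj_range Q) (submval x).
  rewrite proj_rangeQ -[LHS]/((p * (Q - p)) (submval x)).
  by rewrite mulrBr pQ pp.
apply: xget_unique => // T' T'P; apply: adjointable_ext => x.
by apply: val_inj; exact: etrans (T'P x) (esym (TE x)).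
Qed.

Let B : 'L('R(Q)) := compress psa p_in p_id c.
Local Notation ext := (extend psa p_in p_id).
Local Notation cmp := (compress psa p_in p_id).

Let cmpM (S1 S2 : 'L(H)) : GRing.comm p S2 ->
  cmp S1 ** cmp S2 = cmp (S1 * S2).
Proof.
move=> pS2; apply: (extend_inj (psa := psa) (p_in := p_in) (p_id := p_id)).
rewrite extendM !extend_compress.
rewrite (_ : _ * _ = p * S1 * (p * p * S2) * p); last by ncring.
rewrite pp pS2 (_ : _ * (_ * p) * p = p * (S1 * S2) * (p * p)); last by ncring.
by rewrite pp.
Qed.

Let cmp1 : cmp 1 = aid.
Proof.
apply: (extend_inj (psa := psa) (p_in := p_in) (p_id := p_id)).
by rewrite extend_compress extend1 mulr1 pp.
Qed.

Let extTT : ext (T ** T^⋆ + aid) = c * c * p.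
Proof.
rewrite extendD extend1 (_ : ext _ = p * (Q - p) * p' * (Q^⋆ - p) * p).
  rewrite [p * (Q - p)]mulrBr pQ pp (_ : (Q - p) * p' = Q - p); last first.
    rewrite /p' (_ : _ * _ = Q - p - Q * p + p * p); last by ncring.
    by rewrite pp Qp subrK.
  rewrite -mulrA (_ : (Q^⋆ - p) * p = Q^⋆ - p); last by rewrite mulrBl Q'p pp.
  rewrite ccp (_ : _ * _ = Q * Q^⋆ - Q * p - p * Q^⋆ + p * p); last by ncring.
  by rewrite Qp pQ' pp; ncring.
have -> : Q^⋆ - p = (Q - p)^⋆ by rewrite adjointD adjointN psa.
exact: adjointable_ext.
Qed.

Let pp' : p * p' = 0. Proof. by rewrite mulrBr mulr1 pp subrr. Qed.
Let p'p : p' * p = 0. Proof. by rewrite mulrBl mul1r pp subrr. Qed.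
Let p'p' : p' * p' = p'. Proof. by rewrite mulrBr mulr1 p'p subr0. Qed.

Let commp' b : GRing.comm b p -> GRing.comm b p'.
Proof. by move=> bp; apply: commrB => //; exact: commr1. Qed.

Let p_ext (S : 'L('R(Q))) : p * ext S = ext S.
Proof.
have := extendM psa p_in p_id aid S; rewrite extend1 => <-.
by congr ext; exact: adjointable_ext.
Qed.

Let ext_p (S : 'L('R(Q))) : ext S * p = ext S.
Proof.
have := extendM psa p_in p_id S aid; rewrite extend1 => <-.
by congr ext; exact: adjointable_ext.
Qed.

(* S + c (I - p) is a positive square root of c^2 on the whole of H. *)
Let mp_BE : mp_B Q = B.
Proof.
have cmp_adj (S : 'L(H)) : (cmp S)^⋆ = cmp S^⋆ by exact: adjointable_ext.
rewrite /mp_B mp_AE; apply: xget_unique.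
  split; first by exists (cmp D); rewrite cmp_adj Dsa cmpM// DD.
  apply: (extend_inj (psa := psa) (p_in := p_in) (p_id := p_id)).
  have pcc : GRing.comm p (c * c) by apply: commrM; exact: commr_sym.
  by rewrite extTT cmpM// extend_compress pcc -mulrA pp.
move=> S [[Y SY] SS].
apply: (extend_inj (psa := psa) (p_in := p_in) (p_id := p_id)).
rewrite extend_compress; set s := ext S; pose y := ext Y.
have Dp' : GRing.comm p' D by apply/commr_sym/commp'/commr_sym.
have cp' : GRing.comm p' c by apply/commr_sym/commp'.
have sy : s = y^⋆ * y by rewrite /s SY extendM extend_adjoint.
have ss : s * s = c * c * p by rewrite -extendM SS extTT.
have ps : p * s = s by exact: p_ext.
have sp : s * p = s by exact: ext_p.
have py : p * y = y by exact: p_ext.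
have yp : y^⋆ * p = y^⋆ by rewrite -[in RHS]py adjointM psa.
suff : s + c * p' = c.
  move=> sc; rewrite -sc mulrDr mulrDl p_ext ext_p.
  by rewrite -(mulrA p) -(mulrA c) p'p !mulr0 addr0.
apply: (@positive_sqrt_unique _ _ _ c _ (y + D * p') q) => //.
- rewrite adjointD adjointM p'sa Dsa (_ : (_ + _) * _ =
    y^⋆ * y + y^⋆ * (D * p') + p' * D * y + p' * (D * D) * p'); last by ncring.
  rewrite -sy DD -yp -{2}py (_ : _ * (D * p') = y^⋆ * (p * D) * p'); last by ncring.
  rewrite Dp (_ : y^⋆ * _ * p' = y^⋆ * D * (p * p')); last by ncring.
  rewrite pp' mulr0 addr0 (_ : p' * D * _ = D * (p' * p) * y).
    by rewrite p'p mulr0 mul0r addr0 cp' -mulrA p'p'.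
  by rewrite Dp'; ncring.
- rewrite (_ : (_ + _) * _ = s * s + s * (c * p') + c * (p' * s) + c * (p' * c) * p').
    rewrite -{3}sp (_ : _ * (c * p') = s * (p * c) * p'); last by ncring.
    rewrite -cp (_ : s * _ * p' = s * c * (p * p')); last by ncring.
    rewrite -{4}ps (mulrA p') p'p pp' mul0r !mulr0 !addr0 ss cp'.
    rewrite (_ : c * _ * p' = c * c * (p' * p')); last by ncring.
    by rewrite p'p' /p'; ncring.
  by ncring.
Qed.

Let ciE : ainv B = cmp ci.
Proof.
by apply: ainv_eq; rewrite cmpM ?cic ?cci ?cmp1//; exact: commr_sym.
Qed.

Let BB : B ** (B + aid) = cmp (c * (c + 1)).
Proof.
have -> : B + aid = cmp (c + 1).
  apply: (extend_inj (psa := psa) (p_in := p_in) (p_id := p_id)).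
  rewrite extendD extend1 !extend_compress mulrDr mulr1 mulrDl pp.
  by [].
by rewrite cmpM//; apply: commrD; [exact: commr_sym|exact: commr1].
Qed.

Let cieE : ainv (B ** (B + aid)) = cmp (ci * e).
Proof.
rewrite BB; have h : ci * e * (c * (c + 1)) = 1.
  have [_ _ ce'] := comm_roots (commr_refl c).
  rewrite (_ : _ * _ = ci * (e * c) * (c + 1)); last by ncring.
  by rewrite -ce' mulrA cic mul1r.
have pce : GRing.comm p (c * (c + 1)).
  by apply: commrM; [|apply: commrD; [|exact: commr1]]; exact: commr_sym.
have pcie : GRing.comm p (ci * e) by exact: commrM.
apply: ainv_eq; rewrite cmpM// ?h ?cmp1//.
rewrite (_ : _ * _ = c * ((c + 1) * ci * e)); last by ncring.
have cic1 : GRing.comm ci (c + 1).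
  by apply: commrD; [rewrite /GRing.comm cic cci|exact: commr1].
by rewrite -cic1 -mulrA ce mulr1 cci cmp1.
Qed.

Lemma matched_projection_sum : ~ is_projection Q ->
  c * c = Q * Q^⋆ + Q^⋆ * Q - Q - Q^⋆ + 1 ->
  matched_projection Q + matched_projection Q = 1 + ci * (Q + Q^⋆ - 1).
Proof.
move=> nproj ccE; rewrite /matched_projection asboolF// mp_UE mp_AE mp_BE.
rewrite cieE ciE.
pose M1 := p * c * p * ci * p + p * ci * p + p * ci * p * (Q - p) * p'.
pose M2 := p' * (Q - p)^⋆ * p * ci * p
  + p' * (Q - p)^⋆ * p * (ci * e) * p * (Q - p) * p'.
rewrite (_ : _ ** U = 2^-1 *: M1 + 2^-1 *: M2); last exact: adjointable_ext.
have pQp : p * (Q - p) = Q - p by rewrite mulrBr pQ pp.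
have Qpp' : (Q - p) * p' = Q - p.
  rewrite /p' (_ : _ * _ = Q - p - Q * p + p * p); last by ncring.
  by rewrite pp Qp subrK.
have Qpa : (Q - p)^⋆ = Q^⋆ - p by rewrite adjointD adjointN psa.
have p'Q' : p' * (Q^⋆ - p) = Q^⋆ - p.
  by rewrite -Qpa -[in RHS]Qpp' adjointM p'sa.
have Q'pp : (Q^⋆ - p) * p = Q^⋆ - p by rewrite mulrBl Q'p pp.
have pcip : p * ci * p = ci * p by rewrite cip -mulrA pp.
have M1E : M1 = p + ci * Q.
  rewrite /M1 (_ : p * c * p * ci * p = p * c * (p * ci * p)); last by ncring.
  rewrite pcip (_ : p * c * _ = p * (c * ci) * p); last by ncring.
  rewrite cci mulr1 pp (_ : _ * p' = ci * (p * ((Q - p) * p'))); last by ncring.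
  by rewrite Qpp' pQp; ncring.
have ciQp : GRing.comm (Q^⋆ - p) ci.
  by apply/commr_sym/commrB; apply/commr_sym.
have eQp : GRing.comm (Q^⋆ - p) e.
  apply/commr_sym/commrB; apply/commr_sym => //.
  by have [] := comm_roots (commr_sym cQ').
have pcie : p * (ci * e) * p = ci * e * p.
  by rewrite (_ : GRing.comm p (ci * e)); [rewrite -mulrA pp|exact: commrM].
have ciec : ci * e * (c * c - 1) = 1 - ci.
  rewrite (_ : _ * _ = ci * (e * (c + 1)) * (c - 1)); last by ncring.
  by rewrite ec mulr1 mulrBr mulr1 cic.
have M2E : M2 = ci * (Q^⋆ - p) + (1 - ci) * (1 - p).
  rewrite /M2 Qpa p'Q' Q'pp.
  rewrite ciQp -mulrA Q'pp; congr (_ + _).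
  rewrite (_ : _ * p' = (Q^⋆ - p) * (ci * e) * (p * ((Q - p) * p'))); last by ncring.
  rewrite Qpp' pQp (_ : GRing.comm (Q^⋆ - p) (ci * e)); last exact: commrM.
  rewrite -ciec -mulrA (_ : _ * (Q - p) = (c * c - 1) * (1 - p)) ?mulrA//.
  rewrite (_ : _ * (Q - p) = Q^⋆ * Q - Q^⋆ * p - p * Q + p * p); last by ncring.
  rewrite Q'p pQ pp (_ : _ * (1 - p) = c * c - 1 - c * c * p + p); last by ncring.
  by rewrite ccp ccE; ncring.
have half (x : 'L(H)) : 2^-1 *: x + 2^-1 *: x = x.
  by rewrite -scalerDl -[2^-1]mul1r -splitr scale1r.
by rewrite addrACA !half M1E M2E; ncring.
Qed.

End Matched.

Theorem theorem4p19 (R : realType) (A : cstarAlgType R) (H : hilbertModType A)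
  (P Q : 'L(H)) (hPQ : quasi_projection_pair P Q)
  (hnorm : (opnorm (P - Q)%R < 1%:E)%E) :
  P = matched_projection Q /\ (opnorm Q < (5 / 3)%:E)%E.
Proof.
have [r r01 PQr] := opnorm_ltP hnorm.
have [c [q [csa q23 cq cJ [cP cQ cQ']]]] :=
  quasi_projection_structure hPQ r01 PQr.
have [[PP _] QQ _ _ _] := hPQ.
have {}PP : P * P = P := PP.
have {}QQ : Q * Q = Q := QQ.
have /andP[q0 q2] := q23.
have q01 : 0 <= q < 1 by rewrite q0; lra.
have ysa : (1 - c)^⋆ = 1 - c by rewrite adjointD adjointN adjoint1 csa.
have yq : bounded_by (1 - c) q by rewrite -opprB; exact: bounded_byN.
have q02 : 0 <= q < 2 by rewrite q0; lra.
have [D [Dsa Dy DD]] := sqrt1_exists ysa q01 yq.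
have [ci [cisa _ ciy cic]] := inverse1_exists ysa q01 yq.
have [e [_ ey ec]] := inverse_exists ysa q02 yq.
rewrite subKr in DD cic.
have {}ec : e * (c + 1) = 1.
  rewrite -[RHS]ec (_ : 2 = 1 + 1 :> R)// scalar_opD scalar_op1.
  by congr (_ * _); ncring.
have roots b : GRing.comm b c ->
    [/\ GRing.comm b D, GRing.comm b ci & GRing.comm b e].
  move=> bc; have by_ : GRing.comm b (1 - c) by apply: commrB => //; exact: commr1.
  by split; [exact: Dy|exact: ciy|exact: ey].
have JJ : (P + P - 1) * (P + P - 1) = 1.
  rewrite (_ : _ * _ = (P * P + P * P) + (P * P + P * P) - (P + P + P + P) + 1).
    by rewrite PP; ncring.
  by ncring.
have ccL : c * c = (Q + Q^⋆ - 1) * (Q + Q^⋆ - 1).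
  have cJc : GRing.comm c (P + P - 1).
    by apply: commrB; [exact: commrD|exact: commr1].
  rewrite -cJ {2}cJc mulrA -(mulrA c) JJ mulr1.
  by [].
have Q'Q' : Q^⋆ * Q^⋆ = Q^⋆ by rewrite -adjointM QQ.
have ccE : c * c = Q * Q^⋆ + Q^⋆ * Q - Q - Q^⋆ + 1.
  rewrite ccL (_ : _ * _ = Q * Q + Q^⋆ * Q^⋆ + Q * Q^⋆ + Q^⋆ * Q
    - (Q + Q^⋆ + Q + Q^⋆) + 1); last by ncring.
  by rewrite QQ Q'Q'; ncring.
have QcQ : Q * Q^⋆ * Q = c * c * Q.
  rewrite ccE [RHS](_ : _ = Q * Q^⋆ * Q + Q^⋆ * (Q * Q) - Q * Q - Q^⋆ * Q + Q).
    by rewrite QQ; ncring.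
  by ncring.
split.
  suff PPE : P + P = matched_projection Q + matched_projection Q.
    by rewrite -(half_add P) PPE half_add.
  have [Qproj|nproj] := pselect (is_projection Q).
    rewrite /matched_projection asboolT//; have [_ Qsa] := Qproj.
    have c1 : 1 = c.
      apply: (@positive_sqrt_unique _ _ _ c _ 1 q) => //.
        by rewrite adjoint1 mulr1.
      by rewrite ccE Qsa QQ; ncring.
    by move: cJ; rewrite -c1 mul1r Qsa => /addIr.
  rewrite (matched_projection_sum QQ csa q01 cq QcQ cQ cQ' Dsa DD cisa cic ec roots)//.
  by rewrite -cJ mulrA cic mul1r [RHS]addrC subrK.
have cb : bounded_by c (q + 1).
  by rewrite -(subrK 1 c); apply: bounded_byD => //; exact: bounded_by1.
have q10 : 0 <= q + 1 by rewrite addr_ge0.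
apply: le_lt_trans (opnorm_le q10 _) _; last by rewrite lte_fin; lra.
exact: (idempotent_norm_bound csa QcQ cQ cQ' cisa cic roots).
Qed.
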